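(* Over a field $k$, the three notions of Hopf skew-brace with bijective antipode, linear $q$-cycle coalgebra and GV-Hopf skew-brace are equivalent. More precisely: (1) If $(H,\cdot,\mathbin{:})$ is a Hopf skew-brace with bijective antipode $S$, then $(H,\times,T_\times,\cdot,1)$ is a linear $q$-cycle coalgebra, where $1$ is the unit of $H$, $h\times l:=(l\cdot h_{(1)})h_{(2)}$ and $T_\times(h):=S(h_{(1)})^{h_{(2)}}=S(h_{(1)})\cdot S^{-1}(h_{(2)})$. (2) If $(H,\times,T_\times,\cdot,1)$ is a linear $q$-cycle coalgebra, then the coalgebra $H$, endowed with the multiplication $hl:=l_{(2)}\times h^{l_{(1)}}$, is a Hopf algebra with bijective antipode $S(h):=T_\times(h_{(1)})\cdot h_{(2)}$. Moreover, the triple $(H,\times,T_\times)$ is a GV-Hopf skew-brace. (3) If $(H,\times,T_\times)$ is a GV-Hopf skew-brace, then $(H,\cdot,\mathbin{:})$ is a Hopf skew-brace with bijective antipode, where $h\cdot l:=(l_{(1)}\times h)S(l_{(2)})$ and $h\mathbin{:}l:=(h\times l_{(2)})S^{-1}(l_{(1)})$.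
   Context: All vector spaces, maps and tensor products are over $k$ (maps are linear); Sweedler notation is used; $\epsilon$ is the counit; $S$ is the antipode; $H^{\mathrm{cop}}$, $H^{\mathrm{op}}$ denote opposite coalgebra/algebra. Superscripts $h^l$ and multiplication in $H$ bind tighter than $\cdot$, $\mathbin{:}$, $\times$. Exponential notation: given a coalgebra $H$ and a linear map $\cdot\colon H\otimes H\to H$ for which $h\otimes l\mapsto h\cdot l_{(1)}\otimes l_{(2)}$ is invertible with inverse of the form $h\otimes l\mapsto h^{l_{(1)}}\otimes l_{(2)}$, the map $h\otimes l\mapsto h^l$ is the unique one with $(h\cdot l_{(1)})^{l_{(2)}}=h^{l_{(1)}}\cdot l_{(2)}=\epsilon(l)h$ for all $h,l$. Hopf $q$-brace: a triple $(H,\cdot,\mathbin{:})$, $H$ a Hopf algebra, with linear maps $\cdot,\mathbin{:}\colon H\otimes H\to H$ satisfying $\epsilon(x\cdot y)=\epsilon(x\mathbin{:}y)=\epsilon(x)\epsilon(y)$ such that: $H\otimes H^{\mathrm{cop}}\to H^{\mathrm{cop}}\otimes H$, $x\otimes y\mapsto y_{(1)}\mathbin{:}x_{(2)}\otimes x_{(1)}\cdot y_{(2)}$, is a coalgebra morphism; $x\otimes y\mapsto x\cdot y_{(1)}\otimes y_{(2)}$ is invertible; for all $x,y,z$: $(x\cdot y_{(1)})\cdot(z\mathbin{:}y_{(2)})=(x\cdot z_{(2)})\cdot(y\cdot z_{(1)})$, $(x\cdot y_{(1)})\mathbin{:}(z\cdot y_{(2)})=(x\mathbin{:}z_{(2)})\cdot(y\mathbin{:}z_{(1)})$,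 $(x\mathbin{:}y_{(1)})\mathbin{:}(z\mathbin{:}y_{(2)})=(x\mathbin{:}z_{(2)})\mathbin{:}(y\cdot z_{(1)})$; $H$ is a right $H^{\mathrm{op}}$-module via $\cdot$ and via $\mathbin{:}$; and $hm\cdot l=(h\cdot(l_{(1)}\mathbin{:}m_{(2)}))(m_{(1)}\cdot l_{(2)})$, $hm\mathbin{:}l=(h\mathbin{:}(l_{(1)}\cdot m_{(2)}))(m_{(1)}\mathbin{:}l_{(2)})$ for all $h,m,l$. It is a Hopf skew-brace if moreover $(m\mathbin{:}h_{(2)})h_{(1)}=(h\cdot m_{(1)})m_{(2)}$ for all $h,m\in H$. ''With bijective antipode'' means that the antipode of $H$ is bijective. Linear $q$-cycle coalgebra: a tuple $(H,\times,T_\times,\cdot,1)$ consisting of a coalgebra $H$ with a distinguished group-like element $1$, a linear map $\times\colon H\otimes H\to H$, a coalgebra morphism $\cdot\colon H\otimes H^{\mathrm{cop}}\to H$ and a linear map $T_\times\colon H\to H$ such that, for all $h,m,l\in H$: 1) there exists a linear map $h\otimes l\mapsto h^l$ with $(h\cdot l_{(1)})^{l_{(2)}}=h^{l_{(1)}}\cdot l_{(2)}=\epsilon(l)h$; 2) $h\otimes m\mapsto hm:=m_{(2)}\times h^{m_{(1)}}$ is a coalgebra morphism from $H\otimes H$ to $H$; 3) $\times$ is associative with identity $1$; 4) $h\mapsto S(h):=T_\times(h_{(1)})\cdot h_{(2)}$ is a coalgebra antiautomorphism of $H$; 5) $(m\times l)\cdot h=(m\cdot h_{(1)})\times(l\cdot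 h_{(2)})$; 6) $h\cdot(m\times l)=(h\cdot m_{(2)})\cdot(l\cdot m_{(1)})$; 7) $h_{(2)}\times T_\times(h_{(1)})=T_\times(h_{(2)})\times h_{(1)}=\epsilon(h)1$; 8) $h\otimes m\mapsto(m_{(2)}\cdot h_{(1)})h_{(2)}S^{-1}(m_{(1)})$ is a coalgebra morphism from $H\otimes H^{\mathrm{cop}}$ to $H$ (products as in 2)). GV-Hopf skew-brace: a tuple $(H,\times,T_\times)$ consisting of a Hopf algebra $H$ with bijective antipode $S$ and linear maps $\times\colon H\otimes H\to H$, $T_\times\colon H\to H$ such that: 1) $\times$ is associative with unity $1$ (the unit of $H$); 2) $(m\times l)h=mh_{(3)}\times T_\times(h_{(2)})\times lh_{(1)}$ for all $h,m,l\in H$; 3) $h\otimes m\mapsto(m_{(1)}\times h)S(m_{(2)})$ is a coalgebra morphism from $H\otimes H^{\mathrm{cop}}$ to $H$; 4) $h\otimes m\mapsto(h\times m_{(2)})S^{-1}(m_{(1)})$ is a coalgebra morphism from $H\otimes H^{\mathrm{cop}}$ to $H$. *)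

(* Defs.v *)
From HB Require Import structures.
From mathcomp Require Import all_boot all_order all_algebra.
From mathcomp Require Import boolp classical_sets.

Set Implicit Arguments.
Unset Strict Implicit.
Unset Printing Implicit Defensive.

Import GRing.Theory.
Local Open Scope ring_scope.
Local Open Scope quotient_scope.

Definition is_bilinear (k : fieldType) (U V W : lmodType k) (f : U -> V -> W) :=
  (forall y, linear (f^~ y)) /\ (forall x, linear (f x)).

(* The tensor product U ⊗ V of two vector spaces: finite formal sums of pairs
   (concatenation being addition) modulo the least congruence that makes the
   pairing bilinear. *)
Section TensorRel.
Variables (k : fieldType) (U V : lmodType k).

Inductive tens_eq : seq (U * V) -> seq (U * V) -> Prop :=
| tens_refl s : tens_eq s s
| tens_sym s t : tens_eq s t -> tens_eq t s
| tens_trans s t u : tens_eq s t -> tens_eq t u -> tens_eq s u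
| tens_cat s s' t t' :
    tens_eq s s' -> tens_eq t t' -> tens_eq (s ++ t) (s' ++ t')
| tens_catC s t : tens_eq (s ++ t) (t ++ s)
| tens_zerol y : tens_eq [:: (0, y)] [::]
| tens_addl x x' y : tens_eq [:: (x + x', y)] [:: (x, y); (x', y)]
| tens_addr x y y' : tens_eq [:: (x, y + y')] [:: (x, y); (x, y')]
| tens_scale a x y : tens_eq [:: (a *: x, y)] [:: (x, a *: y)].

Definition tens_rel : rel (seq (U * V)) := fun s t => `[< tens_eq s t >].

Lemma tens_rel_refl : reflexive tens_rel.
Proof. by move=> s; apply/asboolP; apply: tens_refl. Qed.

Lemma tens_rel_sym : symmetric tens_rel.
Proof.
by move=> s t; apply/asboolP/asboolP => ?; apply: tens_sym.
Qed.

Lemma tens_rel_trans : transitive tens_rel.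
Proof.
move=> t s u /asboolP st /asboolP tu; apply/asboolP.
exact: tens_trans st tu.
Qed.

Canonical tens_equiv := EquivRel tens_rel tens_rel_refl tens_rel_sym tens_rel_trans.

Definition tens : Type := {eq_quot tens_rel}.
HB.instance Definition _ := Choice.on tens.
HB.instance Definition _ := EqQuotient.on tens.

Definition tclass (s : seq (U * V)) : tens := \pi_tens s.

Lemma tens_piP s t : tens_eq s t <-> tclass s = tclass t.
Proof.
split=> [st|/eqmodP/asboolP //].
by apply/eqmodP/asboolP.
Qed.

Lemma tclassK s : tclass (repr s) = s.
Proof. exact: reprK. Qed.

Lemma tclassW (P : tens -> Prop) : (forall s, P (tclass s)) -> forall t, P t.
Proof. by move=> Pc t; rewrite -[t]tclassK. Qed.

Definition tens_seq_scale (a : k) (s : seq (U * V)) :=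
  [seq (a *: p.1, p.2) | p <- s].

Lemma tens_seq_scale_eq a s t :
  tens_eq s t -> tens_eq (tens_seq_scale a s) (tens_seq_scale a t).
Proof.
elim=> {s t} /=.
- by move=> s; apply: tens_refl.
- by move=> s t _; apply: tens_sym.
- by move=> s t u _ st _; apply: tens_trans.
- by move=> s s' t t' _ ss' _ tt'; rewrite /tens_seq_scale !map_cat; apply: tens_cat.
- by move=> s t; rewrite /tens_seq_scale !map_cat; apply: tens_catC.
- by move=> y; rewrite scaler0; apply: tens_zerol.
- by move=> x x' y; rewrite scalerDr; apply: tens_addl.
- by move=> x y y'; apply: tens_addr.
- by move=> b x y; rewrite scalerA mulrC -scalerA; apply: tens_scale.
Qed.

Definition tens_zero : tens := tclass [::].
Definition tens_add (s t : tens) : tens := tclass (repr s ++ repr t).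
Definition tens_scl (a : k) (s : tens) : tens :=
  tclass (tens_seq_scale a (repr s)).

Lemma tens_repr s : tens_eq (repr (tclass s)) s.
Proof. by apply/tens_piP; rewrite tclassK. Qed.

Lemma tens_add_pi s t : tens_add (tclass s) (tclass t) = tclass (s ++ t).
Proof. by apply/tens_piP/tens_cat; apply: tens_repr. Qed.

Lemma tens_scl_pi a s : tens_scl a (tclass s) = tclass (tens_seq_scale a s).
Proof. by apply/tens_piP/tens_seq_scale_eq/tens_repr. Qed.

Lemma tens_addA : associative tens_add.
Proof.
elim/tclassW=> s; elim/tclassW=> t; elim/tclassW=> u.
by rewrite !tens_add_pi catA.
Qed.

Lemma tens_addC : commutative tens_add.
Proof.
elim/tclassW=> s; elim/tclassW=> t; rewrite !tens_add_pi.
exact/tens_piP/tens_catC.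
Qed.

Lemma tens_add0 : left_id tens_zero tens_add.
Proof. by elim/tclassW=> s; rewrite tens_add_pi. Qed.

Lemma tens_sclDl s a b :
  tens_scl (a + b) s = tens_add (tens_scl a s) (tens_scl b s).
Proof.
elim/tclassW: s => s; rewrite !tens_scl_pi tens_add_pi; apply/tens_piP.
elim: s => [|[x y] s IHs] /=; first exact: tens_refl.
rewrite scalerDl -cat1s.
apply: (tens_trans (tens_cat (tens_addl _ _ _) IHs)).
rewrite -[(a *: x, y) :: (_ ++ _)]cat1s -[[:: _; _]]cat1s -catA.
apply: tens_cat; first exact: tens_refl.
rewrite -cat_rcons -cats1 catA.
by apply: tens_cat; [apply: tens_catC | apply: tens_refl].
Qed.

Lemma tens_scl0 s : tens_scl 0 s = tens_zero.
Proof.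
elim/tclassW: s => s; rewrite tens_scl_pi; apply/tens_piP.
elim: s => [|[x y] s IHs] /=; first exact: tens_refl.
by rewrite scale0r; exact: (tens_cat (tens_zerol _) IHs).
Qed.

Lemma tens_scl1 : left_id 1 tens_scl.
Proof.
elim/tclassW=> s; rewrite tens_scl_pi /tens_seq_scale.
by rewrite (eq_map (g := id)) ?map_id // => -[x y] /=; rewrite scale1r.
Qed.

Lemma tens_addN : left_inverse tens_zero (tens_scl (-1)) tens_add.
Proof.
by move=> s; rewrite -[X in tens_add _ X]tens_scl1 -tens_sclDl addNr tens_scl0.
Qed.

HB.instance Definition _ :=
  GRing.isZmodule.Build tens tens_addA tens_addC tens_add0 tens_addN.

Lemma tclassD s t : tclass s + tclass t = tclass (s ++ t).
Proof. exact: tens_add_pi. Qed.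

Lemma tens_sclA a b s : tens_scl a (tens_scl b s) = tens_scl (a * b) s.
Proof.
elim/tclassW: s => s; rewrite !tens_scl_pi /tens_seq_scale -map_comp.
by congr (tclass _); apply: eq_map => -[x y] /=; rewrite scalerA.
Qed.

Lemma tens_sclDr : right_distributive tens_scl +%R.
Proof.
move=> a; elim/tclassW=> s; elim/tclassW=> t.
by rewrite !(tclassD, tens_scl_pi) /tens_seq_scale map_cat.
Qed.

Lemma tens_sclD s : {morph tens_scl^~ s : a b / a + b}.
Proof. by move=> a b; exact: tens_sclDl. Qed.

HB.instance Definition _ :=
  GRing.Zmodule_isLmodule.Build k tens tens_sclA tens_scl1 tens_sclDr tens_sclD.

Lemma tclassZ a s : a *: tclass s = tclass (tens_seq_scale a s).
Proof. exact: tens_scl_pi. Qed.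

Definition tpure (x : U) (y : V) : tens := tclass [:: (x, y)].

End TensorRel.

Notation "U ⊗ V" := (tens U%type V%type) (at level 40, left associativity) : type_scope.
Notation "x ⊗ y" := (tpure x y) (at level 40, left associativity) : ring_scope.

Section TensorTheory.
Variables (k : fieldType) (U V : lmodType k).

Lemma linD (W : lmodType k) (f : U -> W) : linear f -> {morph f : x y / x + y}.
Proof. by move=> lf x y; have := lf 1 x y; rewrite !scale1r. Qed.

Lemma lin0 (W : lmodType k) (f : U -> W) : linear f -> f 0 = 0.
Proof.
by move=> lf; apply: (@addIr _ (f 0)); rewrite -(linD lf) !add0r.
Qed.

Lemma tpure_bilinear : is_bilinear (@tpure k U V).
Proof.
split=> [y a x x'|x a y y'] /=; last first.
  rewrite /tpure tclassZ tclassD.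
  apply/tens_piP; apply: (tens_trans (tens_addr _ _ _)).
  apply: (@tens_cat _ _ _ [:: _] [:: _] [:: _] [:: _]).
    exact/tens_sym/tens_scale.
  exact: tens_refl.
rewrite /tpure tclassZ tclassD.
exact/tens_piP/tens_addl.
Qed.

Lemma tens_sum (t : U ⊗ V) : t = \sum_(p <- repr t) p.1 ⊗ p.2.
Proof.
rewrite -{1}[t]reprK; elim: (repr t) => [|[x y] s IHs].
  by rewrite big_nil.
by rewrite big_cons -IHs /tpure tclassD.
Qed.

Lemma tens_ind (P : U ⊗ V -> Prop) :
  P 0 -> (forall x y, P (x ⊗ y)) -> (forall s t, P s -> P t -> P (s + t)) ->
  forall t, P t.
Proof.
move=> P0 P1 PD t; rewrite [t]tens_sum.
by elim/big_ind: _ => // p _; apply: P1.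
Qed.

Section Lift.
Variables (W : lmodType k) (f : U -> V -> W).

(* The linear map U ⊗ V -> W sending x ⊗ y to f x y.  It is meaningful for
   bilinear f, in which case the choice of the representative is immaterial:
   see tlift_pure. *)
Definition tlift (t : U ⊗ V) : W := \sum_(p <- repr t) f p.1 p.2.

Hypothesis f_bil : is_bilinear f.

Lemma bilDl y : {morph f^~ y : x x' / x + x'}.
Proof. by move=> x x'; have /= := proj1 f_bil y 1 x x'; rewrite !scale1r. Qed.

Lemma bilDr x : {morph f x : y y' / y + y'}.
Proof. by move=> y y'; have /= := proj2 f_bil x 1 y y'; rewrite !scale1r. Qed.

Lemma bil0l y : f 0 y = 0.
Proof. by apply: (@addIr _ (f 0 y)); rewrite -bilDl !add0r. Qed.

Lemma bil0r x : f x 0 = 0.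
Proof. by apply: (@addIr _ (f x 0)); rewrite -bilDr !add0r. Qed.

Lemma bilZl a x y : f (a *: x) y = a *: f x y.
Proof. by have /= := proj1 f_bil y a x 0; rewrite !addr0 bil0l addr0. Qed.

Lemma bilZr a x y : f x (a *: y) = a *: f x y.
Proof. by have /= := proj2 f_bil x a y 0; rewrite !addr0 bil0r addr0. Qed.

Lemma tlift_eq s t : tens_eq s t ->
  \sum_(p <- s) f p.1 p.2 = \sum_(p <- t) f p.1 p.2.
Proof.
elim=> {s t} //.
- by move=> s t u _ -> _ ->.
- by move=> s s' t t' _ ss' _ tt'; rewrite !big_cat /= ss' tt'.
- by move=> s t; rewrite !big_cat /= addrC.
- by move=> y; rewrite !(big_cons, big_nil) /= bil0l addr0.
- by move=> x x' y; rewrite !(big_cons, big_nil) /= !addr0 bilDl.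
- by move=> x y y'; rewrite !(big_cons, big_nil) /= !addr0 bilDr.
- by move=> a x y; rewrite !(big_cons, big_nil) /= !addr0 bilZl bilZr.
Qed.

Lemma tlift_pi s : tlift (tclass s) = \sum_(p <- s) f p.1 p.2.
Proof. exact/tlift_eq/tens_repr. Qed.

Lemma tlift_pure x y : tlift (x ⊗ y) = f x y.
Proof. by rewrite tlift_pi big_cons big_nil addr0. Qed.

Lemma tlift_linear : linear tlift.
Proof.
move=> a; elim/tclassW=> s; elim/tclassW=> t.
rewrite tclassZ tclassD !tlift_pi.
rewrite big_cat big_map /= scaler_sumr; congr (_ + _).
by apply: eq_bigr => p _; rewrite bilZl.
Qed.

End Lift.

Lemma tens_ext (W : lmodType k) (f g : {linear (U ⊗ V)%type -> W}) :
  (forall x y, f (x ⊗ y) = g (x ⊗ y)) -> f =1 g.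
Proof.
move=> fg; elim/tens_ind => [|//|s t fs ft]; first by rewrite !linear0.
by rewrite !linearD fs ft.
Qed.

End TensorTheory.

Section TensorMaps.
Variable k : fieldType.

Lemma tpureDl (U V : lmodType k) (x x' : U) (y : V) :
  (x + x') ⊗ y = x ⊗ y + x' ⊗ y.
Proof. exact: (bilDl (@tpure_bilinear k U V)). Qed.

Lemma tpureDr (U V : lmodType k) (x : U) (y y' : V) :
  x ⊗ (y + y') = x ⊗ y + x ⊗ y'.
Proof. exact: (bilDr (@tpure_bilinear k U V)). Qed.

Lemma tpureZl (U V : lmodType k) a (x : U) (y : V) : (a *: x) ⊗ y = a *: (x ⊗ y).
Proof. exact: (bilZl (@tpure_bilinear k U V)). Qed.

Lemma tpureZr (U V : lmodType k) a (x : U) (y : V) : x ⊗ (a *: y) = a *: (x ⊗ y).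
Proof. exact: (bilZr (@tpure_bilinear k U V)). Qed.

Definition tpureE := (tpureDl, tpureDr, tpureZl, tpureZr).

Lemma tpure0l (U V : lmodType k) (y : V) : (0 : U) ⊗ y = 0.
Proof. exact: (bil0l (@tpure_bilinear k U V)). Qed.

Lemma tpure0r (U V : lmodType k) (x : U) : x ⊗ (0 : V) = 0.
Proof. exact: (bil0r (@tpure_bilinear k U V)). Qed.

Section Map.
Variables (U U' V V' : lmodType k) (f : {linear U -> U'}) (g : {linear V -> V'}).

Let tmap_bil : is_bilinear (fun x y => f x ⊗ g y).
Proof. by split=> [y a x x'|x a y y'] /=; rewrite linearP !tpureE. Qed.

Definition tmap : U ⊗ V -> U' ⊗ V' := tlift (fun x y => f x ⊗ g y).

HB.instance Definition _ :=
  GRing.isLinear.Build k (U ⊗ V)%type (U' ⊗ V')%type *:%R tmap (tlift_linear tmap_bil).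

Lemma tmapE x y : tmap (x ⊗ y) = f x ⊗ g y.
Proof. exact: tlift_pure. Qed.
End Map.

Section Swap.
Variables U V : lmodType k.

Let tswap_bil : is_bilinear (fun (x : U) (y : V) => y ⊗ x).
Proof. by split=> [y a x x'|x a y y'] /=; rewrite !tpureE. Qed.

Definition tswap : U ⊗ V -> V ⊗ U := tlift (fun x y => y ⊗ x).

HB.instance Definition _ :=
  GRing.isLinear.Build k (U ⊗ V)%type (V ⊗ U)%type *:%R tswap (tlift_linear tswap_bil).

Lemma tswapE x y : tswap (x ⊗ y) = y ⊗ x.
Proof. exact: tlift_pure. Qed.
End Swap.

Section Assoc.
Variables U V W : lmodType k.

Let bil1 (z : W) : is_bilinear (fun (x : U) (y : V) => x ⊗ (y ⊗ z)).
Proof. by split=> [y a x x'|x a y y'] /=; rewrite !tpureE. Qed.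

Let bil2 : is_bilinear
  (fun (t : U ⊗ V) (z : W) => tlift (fun x y => x ⊗ (y ⊗ z)) t).
Proof.
split=> [z|t a z z'] /=; first exact: tlift_linear.
elim/tens_ind: t => [|x y|s t IHs IHt].
- by rewrite !(lin0 (tlift_linear (bil1 _))) scaler0 addr0.
- by rewrite !(tlift_pure (bil1 _)) !tpureE.
- rewrite !(linD (tlift_linear (bil1 _))) IHs IHt scalerDr.
  by rewrite addrACA.
Qed.

Definition tassoc : (U ⊗ V) ⊗ W -> U ⊗ (V ⊗ W) :=
  tlift (fun t z => tlift (fun x y => x ⊗ (y ⊗ z)) t).

HB.instance Definition _ :=
  GRing.isLinear.Build k ((U ⊗ V) ⊗ W)%type (U ⊗ (V ⊗ W))%type *:%R tassoc
    (tlift_linear bil2).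

Lemma tassocE x y z : tassoc (x ⊗ y ⊗ z) = x ⊗ (y ⊗ z).
Proof. by rewrite /tassoc (tlift_pure bil2) (tlift_pure (bil1 z)). Qed.
End Assoc.

(* (a ⊗ b) ⊗ (c ⊗ d) |-> (a ⊗ c) ⊗ (b ⊗ d) *)
Section Middle.
Variables A B C D : lmodType k.

Let bil1 (c : C) (d : D) :
  is_bilinear (fun (a : A) (b : B) => (a ⊗ c) ⊗ (b ⊗ d)).
Proof. by split=> [y a x x'|x a y y'] /=; rewrite !tpureE. Qed.

Let bil2 (s : A ⊗ B) : is_bilinear (fun (c : C) (d : D) =>
  tlift (fun a b => (a ⊗ c) ⊗ (b ⊗ d)) s).
Proof.
split=> [d e c c'|c e d d'] /=; elim/tens_ind: s => [|x y|s t IHs IHt].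
- by rewrite !(lin0 (tlift_linear (bil1 _ _))) scaler0 addr0.
- by rewrite !(tlift_pure (bil1 _ _)) !tpureE.
- by rewrite !(linD (tlift_linear (bil1 _ _))) IHs IHt scalerDr addrACA.
- by rewrite !(lin0 (tlift_linear (bil1 _ _))) scaler0 addr0.
- by rewrite !(tlift_pure (bil1 _ _)) !tpureE.
- by rewrite !(linD (tlift_linear (bil1 _ _))) IHs IHt scalerDr addrACA.
Qed.

Let bil3 : is_bilinear (fun (s : A ⊗ B) (t : C ⊗ D) =>
  tlift (fun c d => tlift (fun a b => (a ⊗ c) ⊗ (b ⊗ d)) s) t).
Proof.
split=> [t e s s'|s e t t'] /=; last exact: (tlift_linear (bil2 s)).
elim/tens_ind: t => [|c d|t t' IHt IHt'].
- by rewrite !(lin0 (tlift_linear (bil2 _))) scaler0 addr0.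
- by rewrite !(tlift_pure (bil2 _)) (tlift_linear (bil1 _ _)).
- by rewrite !(linD (tlift_linear (bil2 _))) IHt IHt' scalerDr addrACA.
Qed.

Definition tmid : (A ⊗ B) ⊗ (C ⊗ D) -> (A ⊗ C) ⊗ (B ⊗ D) :=
  tlift (fun s t => tlift (fun c d =>
    tlift (fun a b => (a ⊗ c) ⊗ (b ⊗ d)) s) t).

HB.instance Definition _ :=
  GRing.isLinear.Build k ((A ⊗ B) ⊗ (C ⊗ D))%type ((A ⊗ C) ⊗ (B ⊗ D))%type *:%R tmid
    (tlift_linear bil3).

Lemma tmidE a b c d : tmid ((a ⊗ b) ⊗ (c ⊗ d)) = (a ⊗ c) ⊗ (b ⊗ d).
Proof.
by rewrite /tmid (tlift_pure bil3) (tlift_pure (bil2 _)) (tlift_pure (bil1 _ _)).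
Qed.
End Middle.

End TensorMaps.

HB.mixin Record isCoalgebra (k : fieldType) C of GRing.Lmodule k C := {
  comult : C -> C ⊗ C;
  counit : C -> k;
  comult_linear : linear comult;
  counit_scalar : scalar counit;
  comultA : forall x : C,
    tassoc (tlift (fun x1 x2 : C => comult x1 ⊗ x2) (comult x)) =
    tlift (fun x1 x2 : C => x1 ⊗ comult x2) (comult x);
  counitl : forall x : C,
    tlift (fun x1 x2 : C => counit x1 *: x2) (comult x) = x;
  counitr : forall x : C,
    tlift (fun x1 x2 : C => counit x2 *: x1) (comult x) = x
}.

#[short(type="coalgType")]
HB.structure Definition Coalgebra (k : fieldType) :=
  {C of GRing.Lmodule k C & isCoalgebra k C}.

HB.instance Definition _ (k : fieldType) (C : coalgType k) :=
  GRing.isLinear.Build k C (C ⊗ C)%type *:%R (@comult k C) comult_linear.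
HB.instance Definition _ (k : fieldType) (C : coalgType k) :=
  GRing.isLinear.Build k C k *%R (@counit k C) counit_scalar.

Section CoalgebraTheory.
Variables (k : fieldType) (C : coalgType k).
Implicit Type x : C.

Lemma comultA_map x :
  tassoc (tmap comult idfun (comult x)) = tmap idfun comult (comult x).
Proof. exact: comultA. Qed.

Lemma counitl_bil : is_bilinear (fun x1 x2 : C => counit x1 *: x2).
Proof.
split=> [y a x x'|x a y y']; first by rewrite linearP scalerDl scalerA.
by rewrite scalerDr !scalerA mulrC.
Qed.

Lemma counitr_bil : is_bilinear (fun x1 x2 : C => counit x2 *: x1).
Proof.
split=> [y a x x'|x a y y']; last by rewrite linearP scalerDl scalerA.
by rewrite scalerDr !scalerA mulrC.
Qed.

End CoalgebraTheory.

(* Sweedler notation: \sw_(x1, x2 <- x) E is the value at comult x of the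
   linear map sending x1 ⊗ x2 to E, where E is bilinear in x1 and x2. *)
Definition sweedler (k : fieldType) (C : coalgType k) (W : lmodType k)
  (x : C) (f : C -> C -> W) : W := tlift f (comult x).

Notation "\sw_ ( x1 , x2 <- x ) E" := (sweedler x (fun x1 x2 => E))
  (at level 41, x1 name, x2 name, x at level 200, E at level 41, right associativity,
   format "\sw_ ( x1 ,  x2  <-  x )  E") : ring_scope.

Definition cop (k : fieldType) (C : coalgType k) : Type := C.
Notation "C ^cop" := (cop C%type) (at level 2, format "C ^cop") : type_scope.

Section Cop.
Variables (k : fieldType) (C : coalgType k).

HB.instance Definition _ := GRing.Lmodule.on (C ^cop).

Definition cop_comult (x : C) : C ⊗ C := tswap (comult x).
Definition cop_counit (x : C) : k := counit x.

Let comultE : cop_comult = @tswap k C C \o @comult k C.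
Proof. by []. Qed.

Lemma cop_comult_linear : linear cop_comult.
Proof. by move=> a x y; rewrite comultE /= !linearP. Qed.

Lemma cop_counit_scalar : scalar cop_counit.
Proof. exact: counit_scalar. Qed.

HB.instance Definition _ :=
  GRing.isLinear.Build k C (C ⊗ C)%type *:%R cop_comult
    cop_comult_linear.

Let rev3 (t : C ⊗ (C ⊗ C)) : C ⊗ (C ⊗ C) :=
  tassoc (tswap (tmap idfun (@tswap k C C) t)).

Let rev3E a b c : rev3 (a ⊗ (b ⊗ c)) = c ⊗ (b ⊗ a).
Proof. by rewrite /rev3 tmapE /= !tswapE tassocE. Qed.

Let rev3D : {morph rev3 : s t / s + t}.
Proof. by move=> s t; rewrite /rev3 !linearD. Qed.

Lemma cop_comultA (x : C) :
  tassoc (tlift (fun x1 x2 => cop_comult x1 ⊗ x2) (cop_comult x)) =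
  tlift (fun x1 x2 => x1 ⊗ cop_comult x2) (cop_comult x).
Proof.
transitivity (rev3 (tmap idfun comult (comult x))).
  rewrite -[LHS]/(tassoc (tmap cop_comult idfun (tswap (comult x)))).
  elim/tens_ind: (comult x) => [|a b|s t IHs IHt].
  - by rewrite /rev3 !linear0.
  - rewrite tswapE !tmapE /= /cop_comult.
    elim/tens_ind: (comult b) => [|p q|s t IHs IHt].
    + by rewrite /rev3 tpure0r !linear0 tpure0l linear0.
    + by rewrite tswapE tassocE rev3E.
    + by rewrite tpureDr /rev3 !linearD /= tpureDl linearD /= IHs IHt.
  - by rewrite /rev3 !linearD /= IHs IHt.
rewrite -comultA_map.
rewrite -[RHS]/(tmap idfun cop_comult (tswap (comult x))).
elim/tens_ind: (comult x) => [|a b|s t IHs IHt].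
- by rewrite /rev3 !linear0.
- rewrite tswapE !tmapE /= /cop_comult.
  elim/tens_ind: (comult a) => [|p q|s t IHs IHt].
  + by rewrite /rev3 tpure0l !linear0 tpure0r.
  + by rewrite tswapE tassocE rev3E.
  + by rewrite tpureDl linearD /= rev3D IHs IHt linearD /= tpureDr.
- by rewrite !linearD /= rev3D IHs IHt.
Qed.

Lemma cop_counitl (x : C) :
  tlift (fun x1 x2 => cop_counit x1 *: x2) (cop_comult x) = x.
Proof.
rewrite -[RHS](counitr x) /cop_comult.
elim/tens_ind: (comult x) => [|a b|s t IHs IHt].
- by rewrite linear0 !(lin0 (tlift_linear (@counitl_bil k C)))
             !(lin0 (tlift_linear (@counitr_bil k C))).
- by rewrite tswapE (tlift_pure (@counitl_bil k C)) (tlift_pure (@counitr_bil k C)).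
- by rewrite linearD (linD (tlift_linear (@counitl_bil k C))) IHs IHt
             (linD (tlift_linear (@counitr_bil k C))).
Qed.

Lemma cop_counitr (x : C) :
  tlift (fun x1 x2 => cop_counit x2 *: x1) (cop_comult x) = x.
Proof.
rewrite -[RHS](counitl x) /cop_comult.
elim/tens_ind: (comult x) => [|a b|s t IHs IHt].
- by rewrite linear0 !(lin0 (tlift_linear (@counitl_bil k C)))
             !(lin0 (tlift_linear (@counitr_bil k C))).
- by rewrite tswapE (tlift_pure (@counitl_bil k C)) (tlift_pure (@counitr_bil k C)).
- by rewrite linearD (linD (tlift_linear (@counitr_bil k C))) IHs IHt
             (linD (tlift_linear (@counitl_bil k C))).
Qed.

HB.instance Definition _ := isCoalgebra.Build k (C ^cop)
  cop_comult_linear cop_counit_scalar cop_comultA cop_counitl cop_counitr.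

End Cop.

Section TensorCoalgebra.
Variables (k : fieldType) (C D : coalgType k).

Definition tens_comult (t : C ⊗ D) : (C ⊗ D) ⊗ (C ⊗ D) :=
  tmid (tmap comult comult t).
Definition tens_counit (t : C ⊗ D) : k :=
  tlift (fun (x : C) (y : D) => counit x * counit y : k^o) t.

Let counit_bil :
  is_bilinear (fun (x : C) (y : D) => counit x * counit y : k^o).
Proof.
split=> [y a x x'|x a y y'] /=.
  by rewrite linearP mulrDl -mulrA.
by rewrite linearP mulrDr mulrCA.
Qed.

Lemma tens_comult_linear : linear tens_comult.
Proof. by move=> a s t; rewrite /tens_comult !linearP. Qed.

Lemma tens_counit_scalar : scalar tens_counit.
Proof. exact: tlift_linear counit_bil. Qed.

HB.instance Definition _ :=
  GRing.isLinear.Build k (C ⊗ D)%type ((C ⊗ D) ⊗ (C ⊗ D))%type *:%R tens_comult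
    tens_comult_linear.

Let mid3 (t : (C ⊗ (C ⊗ C)) ⊗ (D ⊗ (D ⊗ D))) :
  (C ⊗ D) ⊗ ((C ⊗ D) ⊗ (C ⊗ D)) := tmap idfun (@tmid k C C D D) (tmid t).

Let mid3E a b c d e f :
  mid3 ((a ⊗ (b ⊗ c)) ⊗ (d ⊗ (e ⊗ f))) = (a ⊗ d) ⊗ ((b ⊗ e) ⊗ (c ⊗ f)).
Proof. by rewrite /mid3 tmidE tmapE /= tmidE. Qed.

Let mid3D : {morph mid3 : s t / s + t}.
Proof. by move=> s t; rewrite /mid3 !linearD. Qed.

Let mid3_l u v :
  tassoc (tmap tens_comult idfun (tmid (u ⊗ v))) =
  mid3 (tassoc (tmap comult idfun u) ⊗ tassoc (tmap comult idfun v)).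
Proof.
elim/tens_ind: u => [|a b|s t IHs IHt].
- by rewrite /mid3 tpure0l !linear0 tpure0l !linear0.
- elim/tens_ind: v => [|c d|s t IHs IHt].
  + by rewrite /mid3 tpure0r !linear0 tpure0r !linear0.
  + rewrite tmidE !tmapE /= /tens_comult tmapE /=.
    elim/tens_ind: (comult a) => [|p q|s t IHs IHt].
    * by rewrite /mid3 !(tpure0l, linear0).
    * elim/tens_ind: (comult c) => [|r z|s t IHs IHt].
      - by rewrite /mid3 !(tpure0l, tpure0r, linear0).
      - by rewrite tmidE !tassocE mid3E.
      - rewrite tpureDr linearD /= !tpureDl !linearD /= IHs IHt.
        by rewrite tpureDr mid3D.
    * rewrite tpureDl linearD /= !tpureDl !linearD /= IHs IHt.
      by rewrite tpureDl mid3D.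
  + by rewrite tpureDr !linearD /= tpureDr mid3D IHs IHt.
- by rewrite tpureDl !linearD /= tpureDl mid3D IHs IHt.
Qed.

Let mid3_r u v :
  tmap idfun tens_comult (tmid (u ⊗ v)) =
  mid3 (tmap idfun comult u ⊗ tmap idfun comult v).
Proof.
elim/tens_ind: u => [|a b|s t IHs IHt].
- by rewrite /mid3 tpure0l !linear0 tpure0l !linear0.
- elim/tens_ind: v => [|c d|s t IHs IHt].
  + by rewrite /mid3 tpure0r !linear0 tpure0r !linear0.
  + by rewrite tmidE !tmapE /= /tens_comult tmapE /mid3 tmidE tmapE.
  + by rewrite tpureDr !linearD /= tpureDr mid3D IHs IHt.
- by rewrite tpureDl !linearD /= tpureDl mid3D IHs IHt.
Qed.

Lemma tens_comultA (t : C ⊗ D) :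
  tassoc (tlift (fun x1 x2 => tens_comult x1 ⊗ x2) (tens_comult t)) =
  tlift (fun x1 x2 => x1 ⊗ tens_comult x2) (tens_comult t).
Proof.
rewrite -[LHS]/(tassoc (tmap tens_comult idfun (tens_comult t))).
rewrite -[RHS]/(tmap idfun tens_comult (tens_comult t)).
elim/tens_ind: t => [|x y|s t IHs IHt].
- by rewrite /tens_comult !linear0.
- by rewrite {2 4}/tens_comult !tmapE mid3_l mid3_r !comultA_map.
- by rewrite !linearD /= IHs IHt.
Qed.

Let counitl_bil2 : is_bilinear (fun s t : C ⊗ D => tens_counit s *: t).
Proof.
split=> [y a x x'|x a y y'] /=.
  by rewrite tens_counit_scalar scalerDl scalerA.
by rewrite scalerDr !scalerA mulrC.
Qed.

Let counitr_bil2 : is_bilinear (fun s t : C ⊗ D => tens_counit t *: s).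
Proof.
split=> [y a x x'|x a y y'] /=.
  by rewrite scalerDr !scalerA mulrC.
by rewrite tens_counit_scalar scalerDl scalerA.
Qed.

Lemma tens_counitl (t : C ⊗ D) :
  tlift (fun x1 x2 => tens_counit x1 *: x2) (tens_comult t) = t.
Proof.
have linL := tlift_linear counitl_bil2.
elim/tens_ind: t => [|x y|s t IHs IHt]; first by rewrite linear0 (lin0 linL).
  rewrite -[x in RHS]counitl -[y in RHS]counitl /tens_comult tmapE /=.
  elim/tens_ind: (comult x) => [|a b|s t IHs IHt].
  - by rewrite tpure0l linear0 (lin0 linL) (lin0 (tlift_linear (@counitl_bil k C)))
               tpure0l.
  - elim/tens_ind: (comult y) => [|c d|s t IHs IHt].
    + by rewrite tpure0r linear0 (lin0 linL)
                 (lin0 (tlift_linear (@counitl_bil k D))) tpure0r.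
    + rewrite tmidE (tlift_pure counitl_bil2) /tens_counit (tlift_pure counit_bil).
      rewrite (tlift_pure (@counitl_bil k C)) (tlift_pure (@counitl_bil k D)).
      by rewrite tpureZl tpureZr scalerA.
    + by rewrite tpureDr linearD (linD linL) IHs IHt
                 (linD (tlift_linear (@counitl_bil k D))) tpureDr.
  - by rewrite tpureDl linearD (linD linL) IHs IHt
               (linD (tlift_linear (@counitl_bil k C))) tpureDl.
by rewrite linearD (linD linL) IHs IHt.
Qed.

Lemma tens_counitr (t : C ⊗ D) :
  tlift (fun x1 x2 => tens_counit x2 *: x1) (tens_comult t) = t.
Proof.
have linL := tlift_linear counitr_bil2.
elim/tens_ind: t => [|x y|s t IHs IHt]; first by rewrite linear0 (lin0 linL).
  rewrite -[x in RHS]counitr -[y in RHS]counitr /tens_comult tmapE /=.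
  elim/tens_ind: (comult x) => [|a b|s t IHs IHt].
  - by rewrite tpure0l linear0 (lin0 linL) (lin0 (tlift_linear (@counitr_bil k C)))
               tpure0l.
  - elim/tens_ind: (comult y) => [|c d|s t IHs IHt].
    + by rewrite tpure0r linear0 (lin0 linL)
                 (lin0 (tlift_linear (@counitr_bil k D))) tpure0r.
    + rewrite tmidE (tlift_pure counitr_bil2) /tens_counit (tlift_pure counit_bil).
      rewrite (tlift_pure (@counitr_bil k C)) (tlift_pure (@counitr_bil k D)).
      by rewrite tpureZl tpureZr scalerA.
    + by rewrite tpureDr linearD (linD linL) IHs IHt
                 (linD (tlift_linear (@counitr_bil k D))) tpureDr.
  - by rewrite tpureDl linearD (linD linL) IHs IHt
               (linD (tlift_linear (@counitr_bil k C))) tpureDl.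
by rewrite linearD (linD linL) IHs IHt.
Qed.

HB.instance Definition _ := isCoalgebra.Build k (C ⊗ D)%type
  tens_comult_linear tens_counit_scalar tens_comultA tens_counitl tens_counitr.

End TensorCoalgebra.

Definition is_grouplike (k : fieldType) (C : coalgType k) (g : C) : Prop :=
  comult g = g ⊗ g /\ counit g = 1.

Definition is_coalg_morphism (k : fieldType) (C D : coalgType k) (f : C -> D) :
    Prop :=
  [/\ linear f,
      forall x, comult (f x) = \sw_(x1, x2 <- x) f x1 ⊗ f x2
    & forall x, counit (f x) = counit x].
Arguments is_coalg_morphism {k} (C D)%_type f.

(* A linear map C ⊗ D -> E is represented by the bilinear map
   f : C -> D -> E of its values on pure tensors. *)
Definition is_coalg_morphism2 (k : fieldType) (C D E : coalgType k)
    (f : C -> D -> E) : Prop :=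
  is_bilinear f /\ is_coalg_morphism (C ⊗ D) E (tlift f).
Arguments is_coalg_morphism2 {k} (C D E)%_type f.

(* The inverse of f, when f is bijective. *)
Definition inverse (T : choiceType) (f : T -> T) (y : T) : T :=
  xget y [set x | f x = y].

Section Braces.
Variables (k : fieldType) (H : coalgType k).
Implicit Types (mul dot colon cross e : H -> H -> H) (S T : H -> H) (one : H).

Record is_hopf_algebra mul one S : Prop := IsHopfAlgebra {
  hopf_mul_bilinear : is_bilinear mul;
  hopf_mulA : associative mul;
  hopf_mul1l : left_id one mul;
  hopf_mul1r : right_id one mul;
  hopf_mul_coalg : is_coalg_morphism2 H H H mul;
  hopf_one_grouplike : is_grouplike one;
  hopf_antipode_linear : linear S;
  hopf_antipodel : forall h, \sw_(h1, h2 <- h) mul (S h1) h2 = counit h *: one;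
  hopf_antipoder : forall h, \sw_(h1, h2 <- h) mul h1 (S h2) = counit h *: one
}.

Definition is_exponential dot e : Prop :=
  is_bilinear e /\
  forall h l, \sw_(l1, l2 <- l) e (dot h l1) l2 = counit l *: h /\
              \sw_(l1, l2 <- l) dot (e h l1) l2 = counit l *: h.

(* h^l: the unique e with is_exponential dot e, when there is one. *)
Definition expo dot : H -> H -> H :=
  xget (fun _ _ => 0) [set e | is_exponential dot e].

(* The product of y and z in the opposite algebra is mul z y. *)
Definition is_right_op_module mul one (act : H -> H -> H) : Prop :=
  (forall x y z, act (act x y) z = act x (mul z y)) /\ (forall x, act x one = x).

Record is_hopf_q_brace mul one S dot colon : Prop := IsHopfQBrace {
  hqb_hopf : is_hopf_algebra mul one S;
  hqb_dot_bilinear : is_bilinear dot;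
  hqb_colon_bilinear : is_bilinear colon;
  hqb_counit_dot : forall x y, counit (dot x y) = counit x * counit y;
  hqb_counit_colon : forall x y, counit (colon x y) = counit x * counit y;
  hqb_coalg : is_coalg_morphism2 H (H ^cop) (H ^cop ⊗ H)
    (fun x y : H => \sw_(x1, x2 <- x) \sw_(y1, y2 <- y) colon y1 x2 ⊗ dot x1 y2);
  hqb_invertible :
    bijective (tlift (fun x y : H => \sw_(y1, y2 <- y) dot x y1 ⊗ y2));
  hqb_cycle1 : forall x y z,
    \sw_(y1, y2 <- y) dot (dot x y1) (colon z y2) =
    \sw_(z1, z2 <- z) dot (dot x z2) (dot y z1);
  hqb_cycle2 : forall x y z,
    \sw_(y1, y2 <- y) colon (dot x y1) (dot z y2) =
    \sw_(z1, z2 <- z) dot (colon x z2) (colon y z1);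
  hqb_cycle3 : forall x y z,
    \sw_(y1, y2 <- y) colon (colon x y1) (colon z y2) =
    \sw_(z1, z2 <- z) colon (colon x z2) (dot y z1);
  hqb_dot_module : is_right_op_module mul one dot;
  hqb_colon_module : is_right_op_module mul one colon;
  hqb_mul_dot : forall h m l, dot (mul h m) l =
    \sw_(m1, m2 <- m) \sw_(l1, l2 <- l)
      mul (dot h (colon l1 m2)) (dot m1 l2);
  hqb_mul_colon : forall h m l, colon (mul h m) l =
    \sw_(m1, m2 <- m) \sw_(l1, l2 <- l)
      mul (colon h (dot l1 m2)) (colon m1 l2)
}.

Definition is_hopf_skew_brace mul one S dot colon : Prop :=
  is_hopf_q_brace mul one S dot colon /\
  forall h m, \sw_(h1, h2 <- h) mul (colon m h2) h1 =
              \sw_(m1, m2 <- m) mul (dot h m1) m2.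

Definition lqc_mul cross dot (h m : H) : H :=
  \sw_(m1, m2 <- m) cross m2 (expo dot h m1).

Definition lqc_antipode T dot (h : H) : H := \sw_(h1, h2 <- h) dot (T h1) h2.

Record is_linear_q_cycle_coalgebra cross T dot one : Prop :=
  IsLinearQCycleCoalgebra {
  lqc_grouplike : is_grouplike one;
  lqc_cross_bilinear : is_bilinear cross;
  lqc_dot_coalg : is_coalg_morphism2 H (H ^cop) H dot;
  lqc_T_linear : linear T;
  lqc_expo : exists e, is_exponential dot e;
  lqc_mul_coalg : is_coalg_morphism2 H H H (lqc_mul cross dot);
  lqc_crossA : associative cross;
  lqc_cross1l : left_id one cross;
  lqc_cross1r : right_id one cross;
  lqc_antipode_coalg : is_coalg_morphism H (H ^cop) (lqc_antipode T dot);
  lqc_antipode_bij : bijective (lqc_antipode T dot);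
  lqc_dot_crossl : forall h m l, dot (cross m l) h =
    \sw_(h1, h2 <- h) cross (dot m h1) (dot l h2);
  lqc_dot_crossr : forall h m l, dot h (cross m l) =
    \sw_(m1, m2 <- m) dot (dot h m2) (dot l m1);
  lqc_Tr : forall h, \sw_(h1, h2 <- h) cross h2 (T h1) = counit h *: one;
  lqc_Tl : forall h, \sw_(h1, h2 <- h) cross (T h2) h1 = counit h *: one;
  lqc_colon_coalg : is_coalg_morphism2 H (H ^cop) H
    (fun h m : H => \sw_(h1, h2 <- h) \sw_(m1, m2 <- m)
       lqc_mul cross dot (lqc_mul cross dot (dot m2 h1) h2)
         (inverse (lqc_antipode T dot) m1))
}.

Definition gv_dot mul S cross (h m : H) : H :=
  \sw_(m1, m2 <- m) mul (cross m1 h) (S m2).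

Definition gv_colon mul S cross (h m : H) : H :=
  \sw_(m1, m2 <- m) mul (cross h m2) (inverse S m1).

Record is_gv_hopf_skew_brace mul one S cross T : Prop := IsGVHopfSkewBrace {
  gv_hopf : is_hopf_algebra mul one S;
  gv_antipode_bij : bijective S;
  gv_cross_bilinear : is_bilinear cross;
  gv_T_linear : linear T;
  gv_crossA : associative cross;
  gv_cross1l : left_id one cross;
  gv_cross1r : right_id one cross;
  gv_cross_mul : forall h m l, mul (cross m l) h =
    \sw_(h1, h' <- h) \sw_(h2, h3 <- h')
      cross (cross (mul m h3) (T h2)) (mul l h1);
  gv_dot_coalg : is_coalg_morphism2 H (H ^cop) H (gv_dot mul S cross);
  gv_colon_coalg : is_coalg_morphism2 H (H ^cop) H (gv_colon mul S cross)
}.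

End Braces.

(* Main.v *)
Require Import Defs.
From mathcomp Require Import all_boot all_order all_algebra.
From mathcomp Require Import boolp classical_sets.
From mathcomp Require Import zify.

Set Implicit Arguments.
Unset Strict Implicit.
Unset Printing Implicit Defensive.

Import GRing.Theory.
Local Open Scope ring_scope.

(** All three structures encode one situation: a Hopf algebra together with a
second associative product [cross] on its underlying coalgebra, having the same
unit, the two products being tied by

  [h × l = (l · h1) * h2 = (h ∶ l2) * l1].

Since the antipode [S] is bijective with inverse [Si], convolving with [S] or
[Si] recovers either action from the two products,
[h · l = (l1 × h) * S l2] and [h ∶ l = (h × l2) * Si l1], while
[h * l = l2 × h^l1] recovers the product [*] from [×] and [·].  So each
passage only has to transport axioms, and every transport is a computation in
Sweedler notation driven by one of these ideas.

- In a Hopf skew-brace, [h^l = h · Si l], because [·] is a module structure.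
  The compatibility of [·] with products gives the associativity of [×] and,
  together with the first cycle identity, [(m × l) · h = (m · h1) × (l · h2)].
  The map [T] is visibly a one-sided inverse of the identity for the convolution
  attached to [×]; the map [Si h2 ∶ S h1], built from the other action, is an
  inverse on the other side, so both maps coincide.

- In a linear q-cycle coalgebra the exponential is determined by one of the
  two identities defining it.  Hence every formula for [h^l], such as
  [(m × l)^h = m^h2 × l^h1], [a^(b * c) = (a^b)^c] and [x^(S l) = x · l], follows
  by checking that the proposed value is inverted by [·].  Associativity of [*]
  and the antipode identities are consequences.

- In a GV-Hopf skew-brace the compatibility of [*] with [×] gives
  [x · y = T (S y1) × (x * S y2)], and from it the module axiom and
  [(m × l) · h = (m · h1) × (l · h2)].  The remaining axioms are proved by
  multiplying both sides by a factor that can be cancelled with [S] or [Si] and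
  recognising the same element written with [×]; for instance the commutation
  of [∶] and [·] comes from comparing two expressions of the coproduct of
  [y × x].

The condition that [y1 ∶ x2 ⊗ x1 · y2] be a coalgebra morphism is used through
an equivalent form (lemmas [braiding_anticomul_dot], [braiding_anticomul_colon],
[braiding_twisted_commute] and [braiding_coalg]): both actions are coalgebra
morphisms from [H ⊗ H^cop] to [H], and
[y2 ∶ x1 ⊗ x2 · y1 = y1 ∶ x2 ⊗ x1 · y2].

Coassociativity, counitality, linearity and the exchange of independent
coproducts are handled once and for all by a normal form: an expression in which
each variable is split by iterated coproducts, its legs being used linearly,
depends only on the number of legs of each variable and on the multilinear
function applied to these legs in their natural order.  The tactic [sw] proves
equalities between expressions with the same normal form, so the proofs below
display only the steps that use an axiom. *)

(** * Linearity and the basic Sweedler identities *)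

Section LinearMaps.
Variable k : fieldType.
Implicit Types U V W X : lmodType k.

Lemma lin_id U : linear (fun x : U => x).
Proof. by []. Qed.

Lemma lin_comp U V W (f : V -> W) (g : U -> V) :
  linear f -> linear g -> linear (fun x => f (g x)).
Proof. by move=> lf lg a x y; rewrite lg lf. Qed.

Lemma lin_bil1 U V W X (f : U -> V -> W) (g : X -> U) y :
  is_bilinear f -> linear g -> linear (fun x => f (g x) y).
Proof. by move=> [lf _] lg; apply: (lin_comp (lf y) lg). Qed.

Lemma lin_bil2 U V W X (f : U -> V -> W) (g : X -> V) x :
  is_bilinear f -> linear g -> linear (fun y => f x (g y)).
Proof. by move=> [_ lf] lg; apply: (lin_comp (lf x) lg). Qed.

Lemma lin_scale U V (c : k) (f : U -> V) :
  linear f -> linear (fun x => c *: f x).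
Proof. by move=> lf a x y; rewrite lf scalerDr !scalerA mulrC. Qed.

Lemma lin_counit (C : coalgType k) U V (f : U -> C) (v : V) :
  linear f -> linear (fun x => counit (f x) *: v).
Proof. by move=> lf a x y; rewrite lf linearP scalerDl scalerA. Qed.

Lemma lin_sum U V (I : Type) (s : seq I) (f : I -> U -> V) :
  (forall i, linear (f i)) -> linear (fun x => \sum_(i <- s) f i x).
Proof.
move=> lf a x y; rewrite scaler_sumr -big_split /=.
by apply: eq_bigr => i _; rewrite lf.
Qed.

Lemma linZ U V (f : U -> V) : linear f -> forall a x, f (a *: x) = a *: f x.
Proof. by move=> lf a x; rewrite -[a *: x]addr0 lf (lin0 lf) addr0. Qed.

Lemma lin_sumE U V (f : U -> V) (I : Type) (s : seq I) (g : I -> U) :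
  linear f -> f (\sum_(i <- s) g i) = \sum_(i <- s) f (g i).
Proof. by move=> lf; apply: big_morph; [apply: linD | apply: lin0]. Qed.

Variable C : coalgType k.
Implicit Types x y : C.

Lemma eq_sw V x (f g : C -> C -> V) :
  (forall a b, f a b = g a b) -> sweedler x f = sweedler x g.
Proof. by move=> fg; apply: eq_bigr => p _; apply: fg. Qed.

Lemma lin_swb U V x (f : U -> C -> C -> V) :
  (forall a b, linear (fun u => f u a b)) ->
  linear (fun u => sweedler x (f u)).
Proof. by move=> lf; apply: lin_sum => p; apply: lf. Qed.

Lemma lin_sw U V (f : C -> C -> V) (g : U -> C) :
  is_bilinear f -> linear g -> linear (fun u => sweedler (g u) f).
Proof.
move=> bf lg; apply: (lin_comp (f := fun x => tlift f (comult x)) _ lg).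
exact: (lin_comp (tlift_linear bf) (@comult_linear k C)).
Qed.

(** A Sweedler expression is a finite sum over a chosen representative of the
    coproduct, so linearity of the outer map suffices: nothing is asked of the
    summand [f]. *)
Lemma sw_hoist V W x (f : C -> C -> V) (g : V -> W) :
  linear g -> g (sweedler x f) = \sw_(a, b <- x) g (f a b).
Proof. exact: lin_sumE. Qed.

Lemma sw_exchange (D : coalgType k) V x (y : D) (f : C -> C -> D -> D -> V) :
  \sw_(a, b <- x) \sw_(c, d <- y) f a b c d =
  \sw_(c, d <- y) \sw_(a, b <- x) f a b c d.
Proof. exact: exchange_big. Qed.

Lemma sw_counitl V x (f : C -> V) :
  linear f -> \sw_(a, b <- x) counit a *: f b = f x.
Proof.
move=> lf; rewrite -[in RHS](counitl x) -[tlift _ _]/(sweedler _ _) sw_hoist //.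
by apply: eq_sw => a b; rewrite linZ.
Qed.

Lemma sw_counitr V x (f : C -> V) :
  linear f -> \sw_(a, b <- x) counit b *: f a = f x.
Proof.
move=> lf; rewrite -[in RHS](counitr x) -[tlift _ _]/(sweedler _ _) sw_hoist //.
by apply: eq_sw => a b; rewrite linZ.
Qed.

(** Coassociativity is an equality of tensors; a trilinear map turns it into an
    equality of its values, by two successive liftings to the tensor product. *)
Lemma sw_coassoc V x (f : C -> C -> C -> V) :
  (forall b c, linear (fun a => f a b c)) ->
  (forall a c, linear (fun b => f a b c)) ->
  (forall a b, linear (fun c => f a b c)) ->
  \sw_(a, b <- x) \sw_(c, d <- a) f c d b =
  \sw_(a, b <- x) \sw_(c, d <- b) f a c d.
Proof.
move=> lf1 lf2 lf3.
have bf a : is_bilinear (f a) by split=> [c|b].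
pose F a := tlift (f a).
have bF : is_bilinear F.
  split=> [t|a]; last exact: (tlift_linear (bf a)).
  by apply: lin_sum => p; apply: lf1.
have lA : linear (@tassoc k C C C) by exact: linearP.
have := congr1 (tlift F) (comultA x).
rewrite -[tlift (fun _ _ => _ ⊗ comult _) _]/(sweedler _ _).
rewrite (sw_hoist _ _ (tlift_linear bF)).
have -> : tlift (fun x1 x2 : C => comult x1 ⊗ x2) (comult x) =
          \sw_(a, b <- x) \sw_(c, d <- a) c ⊗ d ⊗ b.
  apply: eq_sw => a b.
  rewrite -(sw_hoist a _ (g := fun t => t ⊗ b)); last first.
    by case: (tpure_bilinear (C ⊗ C)%type C) => l _; apply: l.
  congr (_ ⊗ _); exact: tens_sum.
rewrite (sw_hoist _ _ lA).
rewrite (sw_hoist _ _ (tlift_linear bF)).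
move=> E; transitivity (\sw_(a, b <- x) tlift F (tassoc (\sw_(c, d <- a) c ⊗ d ⊗ b))).
  apply: eq_sw => a b; rewrite (sw_hoist _ _ lA).
  rewrite (sw_hoist _ _ (tlift_linear bF)); apply: eq_sw => c d.
  by rewrite tassocE (tlift_pure bF) /F (tlift_pure (bf c)).
rewrite {}E; apply: eq_sw => a b.
by rewrite (tlift_pure bF).
Qed.

End LinearMaps.

(** * Normal form of Sweedler expressions *)

Section Legs.
Variables (k : fieldType) (C : coalgType k) (V : lmodType k).
Implicit Types (x : C) (s : seq C) (F : seq C -> V) (n : nat).

(** The right comb of coproducts is closed by a counit, which spares a separate
    case for one leg and gives a meaning to zero legs: the variable then
    contributes the scalar [counit x]. *)
Fixpoint legs n x F : V :=
  if n is n'.+1 then \sw_(a, b <- x) legs n' b (fun s => F (a :: s))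
  else counit x *: F [::].

Definition multilinear n F :=
  forall s t, (size s + size t).+1 = n -> linear (fun x => F (s ++ x :: t)).

Lemma multilinear_cons n F a : multilinear n.+1 F -> multilinear n (fun s => F (a :: s)).
Proof. by move=> lF s t st; apply: (lF (a :: s) t); rewrite -st. Qed.

Lemma multilinear_drop m n F s :
  size s = m -> multilinear (m + n) F -> multilinear n (fun t => F (s ++ t)).
Proof.
move=> sm lF t u tu c x y; rewrite !catA.
by apply: (lF (s ++ t) u); rewrite size_cat sm -addnA -addnS tu.
Qed.

Lemma legs_linear_body (U : lmodType k) n x (F : U -> seq C -> V) :
  (forall s, size s = n -> linear (F^~ s)) ->
  linear (fun u : U => legs n x (F u)).
Proof.
elim: n x F => [|n IHn] x F lF /=; first by apply/lin_scale/lF.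
by apply: lin_swb => a b; apply: IHn => s ss; apply: lF => /=; rewrite ss.
Qed.

Lemma legs_linear n F : multilinear n F -> linear (fun x => legs n x F).
Proof.
elim: n F => [|n IHn] F lF /=; first exact: (lin_counit _ (@lin_id k C)).
apply: (lin_sw _ (@lin_id k C)); split=> [b|a].
  by apply: legs_linear_body => s ss; apply: (lF [::] s); rewrite ss.
exact/IHn/multilinear_cons.
Qed.

Lemma eq_legs n x F F' :
  (forall s, size s = n -> F s = F' s) -> legs n x F = legs n x F'.
Proof.
elim: n x F F' => [|n IHn] x F F' eF /=; first by rewrite eF.
by apply: eq_sw => a b; apply: IHn => s ss; apply: eF; rewrite /= ss.
Qed.

Lemma legs1 x F : multilinear 1 F -> legs 1 x F = F [:: x].
Proof. by move=> lF; apply: sw_counitr (lF [::] [::] _). Qed.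

(** General coassociativity: splitting [x] once and then giving [m] legs to the
    first half and [n] legs to the second half amounts to giving [m + n] legs to
    [x].  By induction on [m], this moves the first split to the bottom of the
    comb. *)
Lemma legs_add m n x F : multilinear (m + n) F ->
  legs (m + n) x F =
  \sw_(a, b <- x) legs m a (fun s => legs n b (fun t => F (s ++ t))).
Proof.
elim: m x F => [|m IHm] x F lF.
  by rewrite /= sw_counitl //; apply: legs_linear.
transitivity (\sw_(a, b <- x) \sw_(c, d <- b)
    legs m c (fun s => legs n d (fun t => F (a :: s ++ t)))).
  by rewrite addSn /=; apply: eq_sw => a b; apply/IHm/multilinear_cons.
rewrite -(@sw_coassoc _ _ _ x (fun a c d =>
  legs m c (fun s => legs n d (fun t => F (a :: s ++ t))))); first last.
- move=> a c; apply: legs_linear_body => s ss; apply: legs_linear => t u tu.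
  move=> e y z; rewrite !catA.
  by apply: (lF (a :: s ++ t) u); rewrite /= size_cat ss -tu addnS addnA.
- move=> a d; apply: legs_linear => s t st; apply: legs_linear_body => u su.
  move=> e y z; rewrite -!catA.
  by apply: (lF (a :: s) (t ++ u)); rewrite size_cat su /= addnA -st.
- move=> c d; apply: legs_linear_body => s ss; apply: legs_linear_body => t st.
  by apply: (lF [::] (s ++ t)); rewrite size_cat ss st.
by apply: eq_sw.
Qed.

Lemma legs_sw n x y (f : seq C -> C -> C -> V) :
  legs n x (fun s => sweedler y (f s)) = \sw_(a, b <- y) legs n x (fun s => f s a b).
Proof.
elim: n x f => [|n IHn] x f /=; last first.
  by rewrite sw_exchange; apply: eq_sw => a b; rewrite IHn.
by rewrite sw_hoist //; apply: lin_scale.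
Qed.

Lemma legsZ n x c F : legs n x (fun s => c *: F s) = c *: legs n x F.
Proof.
elim: n x F => [|n IHn] x F /=; first by rewrite !scalerA mulrC.
rewrite (sw_hoist _ _ (lin_scale c (@lin_id _ V))).
by apply: eq_sw => a b; rewrite IHn.
Qed.

(** The simultaneous version of [legs]: the variables are listed in [env], the
    numbers of legs in [ns], and [F] receives the legs of the first variable,
    then those of the second one, and so on. *)
Fixpoint legs_env (ns : seq nat) (env : seq C) F : V :=
  match ns, env with
  | n :: ns', x :: env' => legs n x (fun s => legs_env ns' env' (fun t => F (s ++ t)))
  | _, _ => F [::]
  end.

Lemma legs_env_linear_body (U : lmodType k) ns env (F : U -> seq C -> V) :
  size ns = size env ->
  (forall s, size s = sumn ns -> linear (F^~ s)) ->
  linear (fun u : U => legs_env ns env (F u)).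
Proof.
elim: ns env F => [|n ns IH] [|x env] F //= sE lF; first by apply: lF.
apply: legs_linear_body => s ss; apply: IH => [|t st]; first by case: sE.
by apply: lF; rewrite size_cat ss st.
Qed.

Lemma legs_env_split ns1 ns2 m n env1 env2 x F :
  size ns1 = size env1 -> size ns2 = size env2 ->
  multilinear (sumn (ns1 ++ (m + n)%N :: ns2)) F ->
  legs_env (ns1 ++ (m + n)%N :: ns2) (env1 ++ x :: env2) F =
  \sw_(a, b <- x) legs_env (ns1 ++ [:: m, n & ns2]) (env1 ++ [:: a, b & env2]) F.
Proof.
move=> s1 s2; elim: ns1 env1 s1 F => [|p ns1 IH] [|y env1] //= s1 F lF.
  rewrite legs_add; last first.
    move=> s t st; apply: legs_env_linear_body => // u su e v w; rewrite -!catA.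
    by apply: (lF s (t ++ u)); rewrite size_cat su addnA -st addSn.
  apply: eq_sw => a b; apply: eq_legs => s _; apply: eq_legs => t _.
  by congr legs_env; apply: funext => u; rewrite catA.
rewrite -legs_sw; apply: eq_legs => s ss; apply: IH; first by case: s1.
exact: (multilinear_drop ss).
Qed.

Lemma legs_env_kill ns1 ns2 env1 env2 x F :
  size ns1 = size env1 ->
  legs_env (ns1 ++ 0%N :: ns2) (env1 ++ x :: env2) F =
  counit x *: legs_env (ns1 ++ ns2) (env1 ++ env2) F.
Proof.
elim: ns1 env1 F => [|p ns1 IH] [|y env1] //= F s1.
rewrite -legsZ; apply: eq_legs => s _; apply: IH; by case: s1.
Qed.

Lemma legs_env1 env F :
  multilinear (size env) F -> legs_env (nseq (size env) 1%N) env F = F env.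
Proof.
elim: env F => [|x env IH] F lF //.
rewrite -[LHS]/(legs 1 x (fun s =>
  legs_env (nseq (size env) 1%N) env (fun t => F (s ++ t)))) legs1.
  by rewrite IH //; apply: multilinear_cons.
move=> [|//] [|//] _; apply: legs_env_linear_body; first by rewrite size_nseq.
by move=> s; rewrite sumn_nseq mul1n => ss; apply: (lF [::]); rewrite ss.
Qed.

(** The effect on numbers of legs of undoing one split: variables [i] and [i.+1]
    become a single one, which carries the legs of both. *)
Definition merge_at i (ns : seq nat) :=
  take i ns ++ (nth 0 ns i + nth 0 ns i.+1)%N :: drop i.+2 ns.

Definition zero_at i (ns : seq nat) := take i ns ++ 0%N :: drop i ns.

(** The normal form of [v].  It is computed from the outside to the inside, with
    [F] unknown until all splits have been performed; the counts [ns] are then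
    reassembled by [merge_at] and [zero_at]. *)
Definition sw_normal (v : V) (ns : seq nat) (env : seq C) F : Prop :=
  [/\ size ns = size env, multilinear (sumn ns) F & v = legs_env ns env F].

(** Multilinearity in a form that, for a numeral [n], computes to one linearity
    goal per leg. *)
Fixpoint multilinear_rec n F : Prop :=
  if n is n'.+1 then
    (forall t, linear (fun x => F (x :: t))) /\
    (forall x, multilinear_rec n' (fun s => F (x :: s)))
  else True.

Lemma multilinear_recP n F : multilinear_rec n F -> multilinear n F.
Proof.
elim: n F => [|n IH] F //= [lF0 lF] [|a s] t [st]; first exact: lF0.
exact: (IH _ (lF a) s t).
Qed.

Lemma sw_normal_leaf n v env F :
  size env = n -> multilinear_rec n F -> v = F env ->
  sw_normal v (nseq n 1%N) env F.
Proof.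
move=> <- /multilinear_recP lF ->.
by split; rewrite ?size_nseq ?sumn_nseq ?mul1n // legs_env1.
Qed.

Lemma sw_normal_split i ns env G F :
  (i < size env)%N ->
  (forall a b, sw_normal (G a b) ns (take i env ++ [:: a, b & drop i.+1 env]) F) ->
  sw_normal (sweedler (nth 0 env i) G) (merge_at i ns) env F.
Proof.
move=> ie nG; have [sz lF _] := nG 0 0.
have {}sz : size ns = (size env).+1.
  rewrite sz size_cat /= size_take size_drop ie; lia.
have Ens : ns = take i ns ++ [:: nth 0%N ns i, nth 0%N ns i.+1 & drop i.+2 ns].
  by rewrite -!drop_nth ?cat_take_drop //; lia.
have Eenv : env = take i env ++ nth 0 env i :: drop i.+1 env.
  by rewrite -drop_nth ?cat_take_drop.
have eF : sumn (merge_at i ns) = sumn ns.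
  by rewrite {2}Ens /merge_at !sumn_cat /= -!addnA.
split; first by rewrite /merge_at size_cat /= size_take size_drop sz; case: ltnP; lia.
  by rewrite eF.
rewrite {2}Eenv /merge_at legs_env_split.
- by apply: eq_sw => a b; have [_ _ ->] := nG a b; rewrite {1}Ens.
- by rewrite !size_take sz ie ltnW.
- by rewrite !size_drop sz.
- by rewrite -[_ ++ _]/(merge_at i ns) eF.
Qed.

Lemma sw_normal_kill i ns env v F :
  (i < size env)%N ->
  sw_normal v ns (take i env ++ drop i.+1 env) F ->
  sw_normal (counit (nth 0 env i) *: v) (zero_at i ns) env F.
Proof.
move=> ie [sz lF ->].
have {}sz : (size ns).+1 = size env.
  rewrite sz size_cat /= size_take size_drop ie; lia.
have Ee : env = take i env ++ nth 0 env i :: drop i.+1 env.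
  by rewrite -drop_nth ?cat_take_drop.
split.
- by rewrite /zero_at size_cat /= size_take size_drop; case: ltnP; lia.
- by rewrite /zero_at sumn_cat /= add0n -sumn_cat cat_take_drop.
rewrite [in RHS]Ee /zero_at legs_env_kill ?cat_take_drop //.
by rewrite !size_take ie; case: ltnP => // ?; lia.
Qed.

(** Two expressions with the same counts and the same function on the legs are
    equal, whatever the shapes of their trees of coproducts. *)
Lemma sw_normal_eq v w ns ns' env F :
  sw_normal v ns env F -> sw_normal w ns' env F -> ns = ns' -> v = w.
Proof. by move=> [_ _ ->] [_ _ ->] ->. Qed.

Lemma sw_normal_hoist (U : lmodType k) ns env F x (f : C -> C -> U) (g : U -> V) :
  linear g -> sw_normal (\sw_(a, b <- x) g (f a b)) ns env F ->
  sw_normal (g (sweedler x f)) ns env F.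
Proof. by move=> lg; rewrite sw_hoist. Qed.

Lemma sw_normal_hoist_scale (U : lmodType k) ns env F c (u : U) (g : U -> V) :
  linear g -> sw_normal (c *: g u) ns env F -> sw_normal (g (c *: u)) ns env F.
Proof. by move=> lg; rewrite linZ. Qed.

End Legs.

Section Comultiplicative.
Variables (k : fieldType) (C : coalgType k).

(** The three predicates below say that a linear [f] is a coalgebra morphism
    [H ⊗ H -> H], [H ⊗ H^cop -> H] or [H -> H^cop], in a form that rewrites
    coproducts of values of [f] without mentioning the tensor product coalgebra;
    see [coalg_morphism2_comul], [coalg_morphism2_anticomul] and
    [coalg_morphism_anticomul]. *)
Definition comul2 (f : C -> C -> C) : Prop :=
  (forall x y, comult (f x y) = \sw_(a, b <- x) \sw_(c, d <- y) f a c ⊗ f b d) /\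
  (forall x y, counit (f x y) = counit x * counit y).

Definition anticomul2 (f : C -> C -> C) : Prop :=
  (forall x y, comult (f x y) = \sw_(a, b <- x) \sw_(c, d <- y) f a d ⊗ f b c) /\
  (forall x y, counit (f x y) = counit x * counit y).

Definition anticomul1 (f : C -> C) : Prop :=
  (forall x, comult (f x) = \sw_(a, b <- x) f b ⊗ f a) /\
  (forall x, counit (f x) = counit x).

Lemma sw_comul2 (V : lmodType k) f x y (g : C -> C -> V) :
  comul2 f -> is_bilinear g ->
  sweedler (f x y) g = \sw_(a, b <- x) \sw_(c, d <- y) g (f a c) (f b d).
Proof.
move=> [cf _] bg; rewrite /sweedler cf.
rewrite (sw_hoist _ _ (tlift_linear bg)); apply: eq_sw => a b.
rewrite (sw_hoist _ _ (tlift_linear bg)); apply: eq_sw => c d.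
by rewrite tlift_pure.
Qed.

Lemma sw_anticomul2 (V : lmodType k) f x y (g : C -> C -> V) :
  anticomul2 f -> is_bilinear g ->
  sweedler (f x y) g = \sw_(a, b <- x) \sw_(c, d <- y) g (f a d) (f b c).
Proof.
move=> [cf _] bg; rewrite /sweedler cf.
rewrite (sw_hoist _ _ (tlift_linear bg)); apply: eq_sw => a b.
rewrite (sw_hoist _ _ (tlift_linear bg)); apply: eq_sw => c d.
by rewrite tlift_pure.
Qed.

Lemma sw_anticomul1 (V : lmodType k) f x (g : C -> C -> V) :
  anticomul1 f -> is_bilinear g ->
  sweedler (f x) g = \sw_(a, b <- x) g (f b) (f a).
Proof.
move=> [cf _] bg; rewrite /sweedler cf.
rewrite (sw_hoist _ _ (tlift_linear bg)); apply: eq_sw => a b.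
by rewrite tlift_pure.
Qed.

Lemma sw_grouplike (V : lmodType k) (g : C) (f : C -> C -> V) :
  is_grouplike g -> is_bilinear f -> sweedler g f = f g g.
Proof. by move=> [cg _] bf; rewrite /sweedler cg tlift_pure. Qed.

Lemma counit_comul2 (V : lmodType k) f x y (v : V) : comul2 f ->
  counit (f x y) *: v = counit x *: (counit y *: v).
Proof. by move=> [_ ->]; rewrite scalerA. Qed.

Lemma counit_anticomul2 (V : lmodType k) f x y (v : V) : anticomul2 f ->
  counit (f x y) *: v = counit x *: (counit y *: v).
Proof. by move=> [_ ->]; rewrite scalerA. Qed.

Lemma counit_anticomul1 (V : lmodType k) f x (v : V) : anticomul1 f ->
  counit (f x) *: v = counit x *: v.
Proof. by move=> [_ ->]. Qed.

Lemma counit_grouplike (V : lmodType k) (g : C) (v : V) :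
  is_grouplike g -> counit g *: v = v.
Proof. by move=> [_ ->]; rewrite scale1r. Qed.

End Comultiplicative.

Create HintDb sw.

(** [lin] proves linearity and bilinearity of an expression by following its
    syntax; facts about the operations are taken from the context. *)
Ltac lin :=
  intros; cbv beta;
  lazymatch goal with
  | |- is_bilinear ?f =>
    first [ solve [ auto with sw ] | exact: tpure_bilinear | split; lin ]
  | |- @GRing.linear_for _ _ _ _ ?f =>
    lazymatch f with
    | (fun z => z) => exact: lin_id
    | (fun z => @sweedler _ _ _ (@?x z) (@?g z)) =>
      lazymatch x with
      | (fun _ => ?c) => refine (@lin_swb _ _ _ _ c g _)
      | _ => lazymatch g with
             | (fun _ => ?h) => refine (@lin_sw _ _ _ _ h x _ _)
             end
      end; lin
    | (fun z => @GRing.scale _ _ (@counit _ _ (@?x z)) (@?v z)) =>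
      lazymatch x with
      | (fun _ => ?c) => refine (@lin_scale _ _ _ _ v _)
      | _ => refine (@lin_counit _ _ _ _ x _ _)
      end; lin
    | (fun z => @GRing.scale _ _ _ (@?v z)) => refine (@lin_scale _ _ _ _ v _); lin
    | (fun z => ?g (@?x z) (@?y z)) =>
      lazymatch y with
      | (fun _ => ?c) => refine (@lin_bil1 _ _ _ _ _ g x c _ _)
      | _ => lazymatch x with
             | (fun _ => ?c) => refine (@lin_bil2 _ _ _ _ _ g y c _ _)
             end
      end; lin
    | (fun z => ?g (@?x z)) =>
      refine (@lin_comp _ _ _ _ g x _ _); [ solve [ auto with sw ] | lin ]
    | ?g ?x => refine (proj2 (_ : is_bilinear g) x); lin
    end
  end.

Ltac sw_index x env :=
  lazymatch env with
  | x :: _ => constr:(0%N)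
  | _ :: ?e => let i := sw_index x e in constr:(i.+1)
  end.

(* Replaces the legs listed in [env] by the entries of the sequence [s], which
   closes the body [G] over its legs. *)
Ltac sw_subst G env i s :=
  lazymatch env with
  | nil => G
  | ?a :: ?e =>
    let P := eval pattern a in G in
    lazymatch P with
    | ?f _ => let G' := eval cbv beta in (f (nth 0 s i)) in sw_subst G' e (i.+1) s
    end
  end.

Ltac sw_leaf tac :=
  tac;
  lazymatch goal with
  | |- @sw_normal ?k ?C ?V ?G ?ns ?env ?F =>
    tryif is_evar F then
      (let F' := constr:(fun s : seq C =>
         ltac:(let r := sw_subst G env 0%N s in exact r)) in
       unify F F') else idtac;
    let n := eval cbn in (size env) in
    apply: (@sw_normal_leaf k C V n); [ done
    | cbn [multilinear_rec nth]; repeat split; lin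
    | cbn [multilinear_rec nth]; try reflexivity ]
  end.

Ltac sw_hoist_sw G s :=
  let P := eval pattern s in G in
  lazymatch P with ?g _ => apply: (sw_normal_hoist (g := g)); [lin | ] end.

Ltac sw_hoist_counit G s :=
  let P := eval pattern s in G in
  lazymatch P with ?g _ => apply: (sw_normal_hoist_scale (g := g)); [lin | ] end.

Ltac sw_expand x f :=
  first
    [ lazymatch x with
      | ?o _ _ =>
        first [ rewrite (sw_comul2 _ _ (f := o) (g := f)); [|solve [auto with sw]|lin]
              | rewrite (sw_anticomul2 _ _ (f := o) (g := f)); [|solve [auto with sw]|lin] ]
      | ?o _ => rewrite (sw_anticomul1 _ (f := o) (g := f)); [|solve [auto with sw]|lin]
      end
    | rewrite (sw_grouplike (g := x) (f := f)); [|solve [auto with sw]|lin]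
    | fail 1 "no comultiplication rule for" x ].

Ltac sw_expand_counit x :=
  first
    [ lazymatch x with
      | ?o _ _ =>
        first [ rewrite (counit_comul2 _ _ _ (f := o)); [|solve [auto with sw]]
              | rewrite (counit_anticomul2 _ _ _ (f := o)); [|solve [auto with sw]] ]
      | ?o _ => rewrite (counit_anticomul1 _ _ (f := o)); [|solve [auto with sw]]
      end
    | rewrite (counit_grouplike (g := x)); [|solve [auto with sw]]
    | fail 1 "no counit rule for" x ].

(** Brings an expression to normal form: an inner coproduct or counit is first
    moved to the top by linearity; at the top, it is performed if it bears on a
    variable, and distributed over the arguments if it bears on the value of a
    map with a known coproduct. *)
Ltac sw_nf tac :=
  cbv beta;
  lazymatch goal with
  | |- @sw_normal ?k ?C ?V ?G ?ns ?env ?F =>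
    lazymatch G with
    | @sweedler _ _ _ ?x ?f =>
      tryif is_var x then
        (let i := sw_index x env in
         apply: (@sw_normal_split k C V i);
         [ done | intros; cbn [take drop cat]; sw_nf tac ])
      else
        lazymatch x with
        | context [@sweedler ?k' ?C' ?U ?x' ?f'] =>
          sw_hoist_sw G (@sweedler k' C' U x' f'); sw_nf tac
        | context [@GRing.scale ?R ?U (@counit ?k' ?C' ?x') ?u] =>
          sw_hoist_counit G (@GRing.scale R U (@counit k' C' x') u); sw_nf tac
        | _ => sw_expand x f; sw_nf tac
        end
    | context [@sweedler ?k' ?C' ?U ?x ?f] =>
      sw_hoist_sw G (@sweedler k' C' U x f); sw_nf tac
    | @GRing.scale _ _ (@counit _ _ ?x) _ =>
      tryif is_var x then
        (let i := sw_index x env in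
         apply: (@sw_normal_kill k C V i);
         [ done | cbn [take drop cat]; sw_nf tac ])
      else (sw_expand_counit x; sw_nf tac)
    | context [@GRing.scale ?R ?U (@counit ?k' ?C' ?x) ?u] =>
      sw_hoist_counit G (@GRing.scale R U (@counit k' C' x) u); sw_nf tac
    | _ => sw_leaf tac
    end
  end.

(** [sw env] proves an equality between two expressions with the same normal form
    over the variables [env]; [sw_with env tac] moreover applies [tac] to the two
    bodies, for identities that do not affect the legs. *)
Ltac sw_with env tac :=
  apply: (@sw_normal_eq _ _ _ _ _ _ _ env);
  [ sw_nf tac | sw_nf tac | try reflexivity ].

Ltac sw env := sw_with env idtac.

(** [swr tac] applies [tac] to the left-hand side of the goal, at the smallest
    depth below its leading coproducts where [tac] succeeds. *)
Ltac swr_under tac := first [ tac | apply: eq_sw => ? ?; swr_under tac ].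

Ltac swr tac := etransitivity; [ swr_under tac; reflexivity | cbv beta ].

(** * Coalgebra morphisms on pure tensors *)

Section CoalgebraMaps.
Variable k : fieldType.

Lemma tlift_swap (U V W : lmodType k) (f : V -> U -> W) (t : U ⊗ V) :
  is_bilinear f -> tlift f (tswap t) = tlift (fun a b => f b a) t.
Proof.
move=> bf; have bf' : is_bilinear (fun a b => f b a) by case: bf.
elim/tens_ind: t => [|a b|s t IHs IHt].
- by rewrite linear0 (lin0 (tlift_linear bf)) (lin0 (tlift_linear bf')).
- by rewrite tswapE (tlift_pure bf) (tlift_pure bf').
- by rewrite linearD (linD (tlift_linear bf)) (linD (tlift_linear bf')) IHs IHt.
Qed.

Lemma sw_cop (C : coalgType k) (V : lmodType k) (x : C) (f : C -> C -> V) :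
  is_bilinear f -> sweedler (x : C ^cop) f = \sw_(a, b <- x) f b a.
Proof. exact: tlift_swap. Qed.

Lemma comultE (C : coalgType k) (x : C) : comult x = \sw_(a, b <- x) a ⊗ b.
Proof. exact: tens_sum. Qed.

Lemma comult_tensE (C D : coalgType k) (x : C) (y : D) :
  comult (x ⊗ y : (C ⊗ D)%type) =
  \sw_(a, b <- x) \sw_(c, d <- y) (a ⊗ c) ⊗ (b ⊗ d).
Proof.
rewrite [LHS]/(tmid (tmap comult comult (x ⊗ y))) tmapE /= [comult x]comultE.
have lM : linear (@tmid k C C D D) by exact: linearP.
have l1 : linear (fun t : C ⊗ C => tmid (t ⊗ comult y)).
  exact: (lin_comp lM (proj1 (tpure_bilinear _ _) (comult y))).
etransitivity; first exact: (sw_hoist _ _ l1).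
apply: eq_sw => a b; rewrite [comult y]comultE.
have l2 : linear (fun t : D ⊗ D => tmid ((a ⊗ b) ⊗ t)).
  exact: (lin_comp lM (proj2 (tpure_bilinear _ _) (a ⊗ b))).
etransitivity; first exact: (sw_hoist _ _ l2).
by apply: eq_sw => c d; rewrite tmidE.
Qed.

Lemma sw_tens (C D : coalgType k) (V : lmodType k) (x : C) (y : D)
    (f : C ⊗ D -> C ⊗ D -> V) :
  is_bilinear f ->
  sweedler (x ⊗ y : (C ⊗ D)%type) f =
  \sw_(a, b <- x) \sw_(c, d <- y) f (a ⊗ c) (b ⊗ d).
Proof.
move=> bf; rewrite /sweedler comult_tensE (sw_hoist _ _ (tlift_linear bf)).
apply: eq_sw => a b; rewrite (sw_hoist _ _ (tlift_linear bf)).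
by apply: eq_sw => c d; rewrite tlift_pure.
Qed.

Lemma counit_tensE (C D : coalgType k) (x : C) (y : D) :
  counit (x ⊗ y : (C ⊗ D)%type) = counit x * counit y.
Proof.
apply: (@tlift_pure k C D k^o (fun a b => counit a * counit b : k^o)).
by split=> [b e a a'|a e b b'] /=; rewrite linearP ?mulrDl ?mulrDr -?mulrA // mulrCA.
Qed.

Lemma coalg_morphism2P (C D E : coalgType k) (f : C -> D -> E) :
  is_coalg_morphism2 C D E f <->
  [/\ is_bilinear f,
      forall x y, comult (f x y) =
        \sw_(a, b <- x) \sw_(c, d <- y) f a c ⊗ f b d
    & forall x y, counit (f x y) = counit x * counit y].
Proof.
have bT (bf : is_bilinear f) : is_bilinear (fun s t => tlift f s ⊗ tlift f t).
  split=> [t|s]; [apply: lin_bil1 (tlift_linear bf) | apply: lin_bil2 (tlift_linear bf)];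
    exact: tpure_bilinear.
split=> [[bf [lf cf ef]]|[bf cf ef]].
  split=> // x y; last by rewrite -counit_tensE -ef tlift_pure.
  rewrite -[f x y](tlift_pure bf) cf sw_tens; last exact: bT.
  by apply: eq_sw => a b; apply: eq_sw => c d; rewrite !tlift_pure.
split=> //; split; first exact: tlift_linear.
  elim/tens_ind => [|x y|s t IHs IHt].
  - by rewrite (lin0 (tlift_linear bf)) /sweedler !linear0 (lin0 (tlift_linear (bT bf))).
  - rewrite tlift_pure // cf sw_tens; last exact: bT.
    by apply: eq_sw => a b; apply: eq_sw => c d; rewrite !tlift_pure.
  - rewrite (linD (tlift_linear bf)) (linD (@comult_linear k E)) IHs IHt.
    by rewrite /sweedler (linD (@comult_linear k _)) (linD (tlift_linear (bT bf))).
elim/tens_ind => [|x y|s t IHs IHt].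
- by rewrite (lin0 (tlift_linear bf)) !linear0.
- by rewrite tlift_pure // ef counit_tensE.
- by rewrite (linD (tlift_linear bf)) !linearD /= IHs IHt.
Qed.

Variable H : coalgType k.

Lemma coalg_morphism2_comul (f : H -> H -> H) :
  is_coalg_morphism2 H H H f <-> is_bilinear f /\ comul2 f.
Proof.
split=> [/coalg_morphism2P[]|[bf [cf ef]]] //.
by apply/coalg_morphism2P.
Qed.

Lemma coalg_morphism2_anticomul (f : H -> H -> H) :
  is_coalg_morphism2 H (H ^cop) H f <-> is_bilinear f /\ anticomul2 f.
Proof.
have E (bf : is_bilinear f) (x y : H) :
    \sw_(a, b <- x) \sw_(c, d <- (y : H ^cop)) f a c ⊗ f b d =
    \sw_(a, b <- x) \sw_(c, d <- y) f a d ⊗ f b c.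
  apply: eq_sw => a b; rewrite sw_cop //; lin.
split=> [/coalg_morphism2P[bf cf ef]|[bf [cf ef]]].
  by split=> //; split=> // x y; rewrite -E // cf.
by apply/coalg_morphism2P; split=> // x y; rewrite cf E.
Qed.

Lemma coalg_morphism_anticomul (f : H -> H) :
  is_coalg_morphism H (H ^cop) f <-> linear f /\ anticomul1 f.
Proof.
have tK : involutive (@tswap k H H).
  move=> t; elim/tens_ind: t => [|a b|s t IHs IHt].
  - by rewrite !linear0.
  - by rewrite !tswapE.
  - by rewrite !linearD /= IHs IHt.
have E x : tswap (\sw_(a, b <- x) f a ⊗ f b) = \sw_(a, b <- x) f b ⊗ f a.
  have lT : linear (@tswap k H H) by exact: linearP.
  rewrite (sw_hoist _ _ lT).
  by apply: eq_sw => a b; rewrite tswapE.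
split=> [[lf cf ef]|[lf [cf ef]]]; split=> //.
  by split=> // x; rewrite -E -cf; symmetry; apply: tK.
by move=> x; rewrite -[RHS]tK E -cf.
Qed.

End CoalgebraMaps.

(** * The braiding map of a Hopf q-brace *)

Section LeftCop.
Variables (k : fieldType) (H : coalgType k).

(** The coproduct of [H^cop ⊗ H], read on [H ⊗ H]: with a single carrier,
    expressions mixing both coalgebras need no change of type. *)
Definition copl_comult (t : H ⊗ H) : (H ⊗ H) ⊗ (H ⊗ H) :=
  comult (t : (H ^cop ⊗ H)%type).

Lemma copl_comult_linear : linear copl_comult.
Proof. exact: (@comult_linear k (H ^cop ⊗ H)%type). Qed.

Lemma copl_comult_pure u v :
  copl_comult (u ⊗ v) = \sw_(a, b <- u) \sw_(c, d <- v) (b ⊗ c) ⊗ (a ⊗ d).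
Proof.
etransitivity; first exact: (@comult_tensE k (H ^cop) H u v).
apply: (@sw_cop k H _ u (fun a b => \sw_(c, d <- v) (a ⊗ c) ⊗ (b ⊗ d))).
split; lin.
Qed.

Lemma coalg_morphism2_copl (f : H -> H -> H ⊗ H) :
  is_coalg_morphism2 H (H ^cop) (H ^cop ⊗ H) f <->
  [/\ is_bilinear f,
      forall x y, copl_comult (f x y) =
        \sw_(a, b <- x) \sw_(c, d <- y) f a d ⊗ f b c
    & forall x y, tens_counit (f x y) =
                  counit x * counit y].
Proof.
have E (bf : is_bilinear f) (x y : H) :
    \sw_(a, b <- x) \sw_(c, d <- (y : H ^cop)) f a c ⊗ f b d =
    \sw_(a, b <- x) \sw_(c, d <- y) f a d ⊗ f b c.
  by apply: eq_sw => a b; rewrite sw_cop //; lin.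
split=> [/coalg_morphism2P[bf cf ef]|[bf cf ef]].
  split=> // x y; rewrite -E //; exact: cf.
apply/coalg_morphism2P; split=> // x y.
by etransitivity; [apply: cf | rewrite -E].
Qed.
End LeftCop.

Section BraidingMap.
Variables (k : fieldType) (H : coalgType k).
Variables (dot colon : H -> H -> H).
Hypotheses (dot_bil : is_bilinear dot) (colon_bil : is_bilinear colon).

Definition braiding (x y : H) : H ⊗ H :=
  \sw_(x1, x2 <- x) \sw_(y1, y2 <- y) colon y1 x2 ⊗ dot x1 y2.

(** The part of the coalgebra condition on the braiding that ties the two actions
    to each other; what remains bears on each action separately. *)
Definition twisted_commute : Prop := forall x y,
  \sw_(x1, x2 <- x) \sw_(y1, y2 <- y) colon y2 x1 ⊗ dot x2 y1 =
  \sw_(x1, x2 <- x) \sw_(y1, y2 <- y) colon y1 x2 ⊗ dot x1 y2.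

Lemma braiding_bil : is_bilinear braiding.
Proof. by rewrite /braiding; lin. Qed.

Lemma copl_comult_braiding x y :
  copl_comult (braiding x y) = \sw_(x1, x2 <- x) \sw_(y1, y2 <- y)
    \sw_(u1, u2 <- colon y1 x2) \sw_(v1, v2 <- dot x1 y2)
      (u2 ⊗ v1) ⊗ (u1 ⊗ v2).
Proof.
have lc := @copl_comult_linear k H.
rewrite /braiding (sw_hoist _ _ lc); apply: eq_sw => x1 x2.
by rewrite (sw_hoist _ _ lc); apply: eq_sw => y1 y2; rewrite copl_comult_pure.
Qed.

Section Forward.
Hypotheses (counit_dot : forall x y, counit (dot x y) = counit x * counit y).
Hypotheses (counit_colon : forall x y, counit (colon x y) = counit x * counit y).
Hypothesis braiding_coalg : forall x y, copl_comult (braiding x y) =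
  \sw_(a, b <- x) \sw_(c, d <- y) braiding a d ⊗ braiding b c.

(** Comultiplicativity of the braiding, tested against a pair of bilinear maps.
    Taking for [f] and [g] the two ways of applying the counit to one tensor
    factor extracts from it the three conditions proved next. *)
Lemma braiding_apply (f g : H -> H -> H) : is_bilinear f -> is_bilinear g ->
  forall x y,
  \sw_(x1, x2 <- x) \sw_(y1, y2 <- y)
    (\sw_(u1, u2 <- colon y1 x2) \sw_(v1, v2 <- dot x1 y2) f u2 v1 ⊗ g u1 v2) =
  \sw_(x1, x2 <- x) \sw_(y1, y2 <- y)
    (\sw_(a1, a2 <- x1) \sw_(b1, b2 <- y2) f (colon b1 a2) (dot a1 b2)) ⊗
    (\sw_(a1, a2 <- x2) \sw_(b1, b2 <- y1) g (colon b1 a2) (dot a1 b2)).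
Proof.
move=> bf bg x y.
have lF := tlift_linear bf; have lG := tlift_linear bg.
have bFG : is_bilinear (fun s t => tlift f s ⊗ tlift g t).
  by split=> [t|s]; [apply: lin_bil1 lF | apply: lin_bil2 lG]; apply: tpure_bilinear.
have lFG := tlift_linear bFG.
have := congr1 (tlift (fun s t => tlift f s ⊗ tlift g t)) (braiding_coalg x y).
rewrite copl_comult_braiding => E.
transitivity (tlift (fun s t => tlift f s ⊗ tlift g t)
  (\sw_(x1, x2 <- x) \sw_(y1, y2 <- y)
    \sw_(u1, u2 <- colon y1 x2) \sw_(v1, v2 <- dot x1 y2)
      (u2 ⊗ v1) ⊗ (u1 ⊗ v2))).
  do 4 (rewrite (sw_hoist _ _ lFG); apply: eq_sw => ? ?).
  by rewrite tlift_pure // !tlift_pure.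
rewrite {}E (sw_hoist _ _ lFG); apply: eq_sw => x1 x2.
rewrite (sw_hoist _ _ lFG); apply: eq_sw => y1 y2.
rewrite tlift_pure // /braiding; congr (_ ⊗ _).
  rewrite (sw_hoist _ _ lF); apply: eq_sw => a1 a2.
  by rewrite (sw_hoist _ _ lF); apply: eq_sw => b1 b2; rewrite tlift_pure.
rewrite (sw_hoist _ _ lG); apply: eq_sw => a1 a2.
by rewrite (sw_hoist _ _ lG); apply: eq_sw => b1 b2; rewrite tlift_pure.
Qed.

Let counit_dotE (v x y : H) : counit (dot x y) *: v = counit x *: (counit y *: v).
Proof. by rewrite counit_dot scalerA. Qed.

Let counit_colonE (v x y : H) : counit (colon x y) *: v = counit x *: (counit y *: v).
Proof. by rewrite counit_colon scalerA. Qed.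

Let keepr_bil : is_bilinear (fun a b : H => counit a *: b) := @counitl_bil k H.
Let keepl_bil : is_bilinear (fun a b : H => counit b *: a) := @counitr_bil k H.

Let braiding_counitl x y :
  \sw_(a1, a2 <- x) \sw_(b1, b2 <- y) counit (colon b1 a2) *: dot a1 b2 = dot x y.
Proof.
transitivity (\sw_(a1, a2 <- x) \sw_(b1, b2 <- y) counit b1 *: (counit a2 *: dot a1 b2)).
  by apply: eq_sw => a1 a2; apply: eq_sw => b1 b2; rewrite counit_colonE.
sw [:: x; y].
Qed.

Let braiding_counitr x y :
  \sw_(a1, a2 <- x) \sw_(b1, b2 <- y) counit (dot a1 b2) *: colon b1 a2 = colon y x.
Proof.
transitivity (\sw_(a1, a2 <- x) \sw_(b1, b2 <- y) counit a1 *: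
    (counit b2 *: colon b1 a2)).
  by apply: eq_sw => a1 a2; apply: eq_sw => b1 b2; rewrite counit_dotE.
sw [:: x; y].
Qed.

Lemma braiding_anticomul_dot : anticomul2 dot.
Proof.
split=> // x y; symmetry.
transitivity (\sw_(x1, x2 <- x) \sw_(y1, y2 <- y)
    (\sw_(a1, a2 <- x1) \sw_(b1, b2 <- y2) counit (colon b1 a2) *: (dot a1 b2)) ⊗
    (\sw_(a1, a2 <- x2) \sw_(b1, b2 <- y1) counit (colon b1 a2) *: (dot a1 b2))).
  by apply: eq_sw => x1 x2; apply: eq_sw => y1 y2; rewrite !braiding_counitl.
rewrite -(braiding_apply keepr_bil keepr_bil).
transitivity (\sw_(x1, x2 <- x) \sw_(y1, y2 <- y)
    counit (colon y1 x2) *: comult (dot x1 y2)).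
  apply: eq_sw => x1 x2; apply: eq_sw => y1 y2; rewrite comultE.
  move: (colon _ _) (dot _ _) => u v.
  sw [:: u; v].
have lc := @comult_linear k H.
rewrite -[in RHS]braiding_counitl.
rewrite (sw_hoist _ _ lc); apply: eq_sw => ? ?.
rewrite (sw_hoist _ _ lc); apply: eq_sw => ? ?.
by rewrite (linZ lc).
Qed.

Lemma braiding_anticomul_colon : anticomul2 colon.
Proof.
split=> // y x; symmetry.
transitivity (\sw_(x1, x2 <- x) \sw_(y1, y2 <- y)
    (\sw_(a1, a2 <- x2) \sw_(b1, b2 <- y1) counit (dot a1 b2) *: (colon b1 a2)) ⊗
    (\sw_(a1, a2 <- x1) \sw_(b1, b2 <- y2) counit (dot a1 b2) *: (colon b1 a2))).
  rewrite sw_exchange; apply: eq_sw => x1 x2; apply: eq_sw => y1 y2.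
  by rewrite !braiding_counitr.
have bt : is_bilinear (fun a b : H => b ⊗ a) by lin.
have lT := tlift_linear bt.
pose E := congr1 (tlift (fun a b : H => b ⊗ a)) (braiding_apply keepl_bil keepl_bil x y).
transitivity (tlift (fun a b : H => b ⊗ a) (\sw_(x1, x2 <- x) \sw_(y1, y2 <- y)
    (\sw_(a1, a2 <- x1) \sw_(b1, b2 <- y2) counit (dot a1 b2) *: (colon b1 a2)) ⊗
    (\sw_(a1, a2 <- x2) \sw_(b1, b2 <- y1) counit (dot a1 b2) *: (colon b1 a2)))).
  do 2 (rewrite (sw_hoist _ _ lT); apply: eq_sw => ? ?).
  by rewrite tlift_pure.
rewrite -{}E.
transitivity (\sw_(x1, x2 <- x) \sw_(y1, y2 <- y)
    counit (dot x1 y2) *: comult (colon y1 x2)).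
  do 2 (rewrite (sw_hoist _ _ lT); apply: eq_sw => ? ?).
  rewrite [in RHS]comultE.
  move: (colon _ _) (dot _ _) => u v.
  transitivity (\sw_(u1, u2 <- u) \sw_(v1, v2 <- v)
      (counit v2 *: u1) ⊗ (counit v1 *: u2)).
    by do 2 (rewrite (sw_hoist _ _ lT); apply: eq_sw => ? ?); rewrite tlift_pure.
  sw [:: u; v].
have lc := @comult_linear k H.
rewrite -[in RHS]braiding_counitr.
rewrite (sw_hoist _ _ lc); apply: eq_sw => ? ?.
rewrite (sw_hoist _ _ lc); apply: eq_sw => ? ?.
by rewrite (linZ lc).
Qed.

Lemma braiding_twisted_commute : twisted_commute.
Proof.
move=> x y.
transitivity (\sw_(x1, x2 <- x) \sw_(y1, y2 <- y)
    (\sw_(a1, a2 <- x1) \sw_(b1, b2 <- y2) counit (dot a1 b2) *: (colon b1 a2)) ⊗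
    (\sw_(a1, a2 <- x2) \sw_(b1, b2 <- y1) counit (colon b1 a2) *: (dot a1 b2))).
  apply: eq_sw => x1 x2; apply: eq_sw => y1 y2.
  by rewrite braiding_counitl braiding_counitr.
rewrite -(braiding_apply keepl_bil keepr_bil).
apply: eq_sw => x1 x2; apply: eq_sw => y1 y2.
move: (colon _ _) (dot _ _) => u v.
sw [:: u; v].
Qed.
End Forward.

Lemma twisted_commuteE (V : lmodType k) (f : H -> H -> V) :
  twisted_commute -> is_bilinear f -> forall x y,
  \sw_(x1, x2 <- x) \sw_(y1, y2 <- y) f (colon y2 x1) (dot x2 y1) =
  \sw_(x1, x2 <- x) \sw_(y1, y2 <- y) f (colon y1 x2) (dot x1 y2).
Proof.
move=> tc bf x y; have lf := tlift_linear bf.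
transitivity (tlift f (\sw_(x1, x2 <- x) \sw_(y1, y2 <- y) colon y2 x1 ⊗ dot x2 y1)).
  by do 2 (rewrite (sw_hoist _ _ lf); apply: eq_sw => ? ?); rewrite tlift_pure.
by rewrite tc; do 2 (rewrite (sw_hoist _ _ lf); apply: eq_sw => ? ?); rewrite tlift_pure.
Qed.

(** In the coproduct of [y1 ∶ x2 ⊗ x1 · y2] and in the tensor product of two
    braidings, the outer factors agree; the two inner factors, which involve the
    middle legs of [x] and [y], are exchanged by [twisted_commute]. *)
Lemma braiding_coalg : anticomul2 dot -> anticomul2 colon -> twisted_commute ->
  is_coalg_morphism2 H (H ^cop) (H ^cop ⊗ H) braiding.
Proof.
move=> ad ac tc; apply/coalg_morphism2_copl; split; first exact: braiding_bil.
- move=> x y; rewrite copl_comult_braiding /braiding.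
  transitivity (\sw_(x1, x' <- x) \sw_(x2, x3 <- x')
    \sw_(y1, y' <- y) \sw_(y2, y3 <- y')
    (\sw_(a1, a2 <- x2) \sw_(b1, b2 <- y2)
      (colon b1 a2 ⊗ dot x1 y3) ⊗ (colon y1 x3 ⊗ dot a1 b2))).
    sw [:: x; y].
  transitivity (\sw_(x1, x' <- x) \sw_(x2, x3 <- x')
    \sw_(y1, y' <- y) \sw_(y2, y3 <- y')
    (\sw_(a1, a2 <- x2) \sw_(b1, b2 <- y2)
      (colon b2 a1 ⊗ dot x1 y3) ⊗ (colon y1 x3 ⊗ dot a2 b1))).
    apply: eq_sw => x1 x4; apply: eq_sw => x2 x3.
    apply: eq_sw => y1 y4; apply: eq_sw => y2 y3; symmetry.
    apply: (twisted_commuteE (f := fun u v =>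
      (u ⊗ dot x1 y3) ⊗ (colon y1 x3 ⊗ v)) tc); lin.
  sw [:: x; y].
- move=> x y; rewrite /braiding.
  have lc : linear (@tens_counit k H H : _ -> k^o) := @tens_counit_scalar k H H.
  rewrite (sw_hoist _ _ lc).
  apply: (@etrans k^o _ (\sw_(x1, x2 <- x) \sw_(y1, y2 <- y)
    counit x1 *: (counit x2 *: (counit y1 *: (counit y2 *: (1 : k^o)))))).
    apply: (@eq_sw _ _ k^o) => x1 x2; rewrite (sw_hoist _ _ lc).
    apply: (@eq_sw _ _ k^o) => y1 y2.
    rewrite [LHS]counit_tensE ac.2 ad.2.
    rewrite mulrACA [X in X * _ = _]mulrC -mulrA; congr (_ * _).
    by rewrite mulrCA; congr (_ * (_ * _)); rewrite [RHS]mulr1.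
  apply: (@etrans k^o _ (counit x *: (counit y *: (1 : k^o)))); last first.
    by congr (_ * _); apply: mulr1.
  sw [:: x; y].
Qed.
End BraidingMap.

(** * The antipode of a Hopf algebra *)

Section TensorProduct.
Variables (k : fieldType) (H : coalgType k) (mul : H -> H -> H).
Hypothesis mul_bil : is_bilinear mul.
Hypothesis mulA : associative mul.

Definition tens_mul (s t : H ⊗ H) : H ⊗ H :=
  tlift (fun a b => tlift (fun c d => mul a c ⊗ mul b d) t) s.

Let bil1 a b : is_bilinear (fun c d => mul a c ⊗ mul b d).
Proof. lin. Qed.

Let bil2 t : is_bilinear (fun a b => tlift (fun c d => mul a c ⊗ mul b d) t).
Proof.
by split=> u; rewrite /tlift; apply: lin_sum => p; lin.
Qed.

Lemma tens_mul_bil : is_bilinear tens_mul.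
Proof.
split=> [t|s]; first exact: tlift_linear.
by apply: lin_sum => p; apply: tlift_linear.
Qed.

Lemma tens_mulE a b c d : tens_mul (a ⊗ b) (c ⊗ d) = mul a c ⊗ mul b d.
Proof. by rewrite /tens_mul tlift_pure // tlift_pure. Qed.

Lemma tens_mulA : associative tens_mul.
Proof.
have [lr ll] := tens_mul_bil.
move=> s t u; elim/tens_ind: s => [|a b|s s' IH IH'].
- by rewrite !(lin0 (lr _)).
- elim/tens_ind: t => [|c d|t t' IH IH'].
  + by rewrite (lin0 (lr _)) (lin0 (ll _)) (lin0 (lr _)).
  + elim/tens_ind: u => [|e f|u u' IH IH'].
    * by rewrite !(lin0 (ll _)).
    * by rewrite !tens_mulE !mulA.
    * by rewrite !(linD (ll _)) IH IH'.
  + by rewrite (linD (lr _)) !(linD (ll _)) (linD (lr _)) IH IH'.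
- by rewrite !(linD (lr _)) IH IH'.
Qed.

Lemma comult_tens_mul x y : comul2 mul ->
  comult (mul x y) = tens_mul (comult x) (comult y).
Proof.
move=> [cm _]; rewrite cm [comult x]comultE [comult y]comultE.
have [lr ll] := tens_mul_bil.
rewrite (sw_hoist _ _ (lr _)); apply: eq_sw => a b.
by rewrite (sw_hoist _ _ (ll _)); apply: eq_sw => c d; rewrite tens_mulE.
Qed.

End TensorProduct.

Section HopfAlgebra.
Variables (k : fieldType) (H : coalgType k).
Variables (mul : H -> H -> H) (one : H) (S : H -> H).
Hypothesis hopf : is_hopf_algebra mul one S.
Local Notation "x * y" := (mul x y) : ring_scope.

Let mul_bil := hopf_mul_bilinear hopf.
Let S_lin := hopf_antipode_linear hopf.
Let one_gl := hopf_one_grouplike hopf.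
Let mulA := hopf_mulA hopf.
Let mul1 := hopf_mul1l hopf.
Let mulr1 := hopf_mul1r hopf.
Let Sl := hopf_antipodel hopf.
Let Sr := hopf_antipoder hopf.

Lemma hopf_comul2 : comul2 mul.
Proof. by have /coalg_morphism2_comul[] := hopf_mul_coalg hopf. Qed.

Let mul_comul := hopf_comul2.

Lemma antipode1 : S one = one.
Proof.
rewrite -[LHS]mulr1 -[RHS]scale1r -one_gl.2 -Sl.
by rewrite sw_grouplike; [|auto with sw|lin].
Qed.

Lemma counit_antipode x : counit (S x) = counit x.
Proof.
have le : linear (@counit k H : _ -> k^o) by exact: linearP.
have := congr1 (@counit k H) (Sl x).
rewrite [counit (_ *: _)](linZ le) one_gl.2 [_ *: _]GRing.mulr1 => <-.
rewrite (sw_hoist _ _ le) -[in LHS](counitr x) -/(sweedler _ _).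
rewrite (sw_hoist _ _ S_lin) (sw_hoist _ _ le); apply: (@eq_sw _ _ k^o) => a b.
by rewrite (linZ S_lin) (linZ le) mul_comul.2 mulrC.
Qed.

(** Both sides are convolution inverses of the product on [H ⊗ H]: evaluate
    [S (x1 * y1) * (x2 * y2) * (S y3 * S x3)] in two ways. *)
Lemma antipode_mul x y : S (x * y) = S y * S x.
Proof.
transitivity (\sw_(x1, x2 <- x) \sw_(y1, y2 <- y)
    S (x1 * y1) * (counit y2 *: (\sw_(x3, x4 <- x2) x3 * S x4))).
  transitivity (\sw_(x1, x2 <- x) S (x1 * y) * (counit x2 *: one)).
    sw_with [:: x; y] ltac:(rewrite ?mulr1).
  symmetry; transitivity (\sw_(x1, x2 <- x)
      S (x1 * y) * (\sw_(x3, x4 <- x2) x3 * S x4)).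
    sw [:: x; y].
  swr ltac:(rewrite Sr).
  by [].
transitivity (\sw_(x1, x2 <- x) \sw_(y1, y2 <- y)
  S (x1 * y1) * (\sw_(x3, x4 <- x2) (x3 * (\sw_(y3, y4 <- y2) y3 * S y4)) * S x4)).
  symmetry; swr ltac:(rewrite Sr).
  sw_with [:: x; y] ltac:(rewrite ?mulr1).
transitivity (\sw_(x1, x2 <- x) \sw_(y1, y2 <- y)
  ((\sw_(a, b <- x1 * y1) S a * b) * (S y2 * S x2))).
  sw_with [:: x; y] ltac:(rewrite -?mulA).
swr ltac:(rewrite Sl).
sw_with [:: x; y] ltac:(rewrite ?mul1).
Qed.

(** Both sides are convolution inverses of the coproduct, as maps from [H] to the
    algebra [H ⊗ H]: evaluate the product of the coproduct of [S x1], of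
    [x2 ⊗ x3] and of [S x5 ⊗ S x4] in two ways. *)
Lemma antipode_anticomul : anticomul1 S.
Proof.
split; last exact: counit_antipode.
pose cm : H -> H ⊗ H := comult; have cm_lin : linear cm := @comult_linear k H.
have [tmul [tmul_bil tmulA tmulE cmM]] : exists tmul : H ⊗ H -> H ⊗ H -> H ⊗ H,
    [/\ is_bilinear tmul, associative tmul,
        forall a b c d, tmul (a ⊗ b) (c ⊗ d) = (a * c) ⊗ (b * d)
      & forall x y, cm (x * y) = tmul (cm x) (cm y)].
  exists (tens_mul mul); split; [exact: tens_mul_bil | exact: tens_mulA | |].
    by move=> a b c d; apply: tens_mulE.
  by move=> x y; apply: comult_tens_mul.
have tmul1 u : tmul u (one ⊗ one) = u.
  elim/tens_ind: u => [|a b|s t IHs IHt]; first exact: (lin0 (proj1 tmul_bil _)).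
    by rewrite tmulE !mulr1.
  by rewrite (linD (proj1 tmul_bil _)) IHs IHt.
have t1mul u : tmul (one ⊗ one) u = u.
  elim/tens_ind: u => [|a b|s t IHs IHt]; first exact: (lin0 (proj2 tmul_bil _)).
    by rewrite tmulE !mul1.
  by rewrite (linD (proj2 tmul_bil _)) IHs IHt.
move=> x; rewrite -/(cm (S x)).
transitivity (\sw_(x1, x2 <- x) tmul (cm (S x1)) (counit x2 *: (one ⊗ one))).
  sw_with [:: x] ltac:(rewrite ?tmul1).
transitivity (\sw_(x1, x2 <- x) tmul (cm (S x1))
    (\sw_(x3, x4 <- x2) (x3 * S x4) ⊗ one)).
  apply: eq_sw => x1 x2; congr (tmul _ _).
  rewrite -(sw_hoist _ _ (proj1 (tpure_bilinear _ _) one)) Sr.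
  sw [:: x2].
transitivity (\sw_(x1, x2 <- x) tmul (cm (S x1))
    (\sw_(x3, x' <- x2) \sw_(x4, x5 <- x') (x3 * S x5) ⊗ (\sw_(u, v <- x4) u * S v))).
  symmetry; apply: eq_sw => x1 x2; congr (tmul _ _).
  swr ltac:(rewrite Sr).
  sw [:: x2].
transitivity (\sw_(x1, x' <- x) \sw_(x2, x3 <- x') tmul (tmul (cm (S x1)) (cm x2))
    (\sw_(a, b <- x3) S b ⊗ S a)).
  transitivity (\sw_(x1, x' <- x) \sw_(x2, x3 <- x') tmul (tmul (cm (S x1))
    (\sw_(c, d <- x2) c ⊗ d)) (\sw_(a, b <- x3) S b ⊗ S a)).
    sw_with [:: x] ltac:(rewrite -?tmulA ?tmulE).
  by do 2 (apply: eq_sw => ? ?); rewrite -comultE.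
transitivity (\sw_(x1, x2 <- x) tmul (cm (\sw_(a, b <- x1) S a * b))
    (\sw_(a, b <- x2) S b ⊗ S a)).
  sw_with [:: x] ltac:(rewrite ?cmM).
swr ltac:(rewrite Sl).
have cm1 : cm one = one ⊗ one := one_gl.1.
sw_with [:: x] ltac:(rewrite ?cm1 ?t1mul).
Qed.

Hypothesis S_bij : bijective S.

Lemma inverseK : cancel (inverse S) S.
Proof.
case: S_bij => g _ gK x.
have := @xgetPex _ x [set y | S y = x]; rewrite -/(inverse S x) /=; apply.
by exists (g x); apply: gK.
Qed.

Lemma antipodeK : cancel S (inverse S).
Proof. by move=> x; apply: (bij_inj S_bij); rewrite inverseK. Qed.

Let S_inj := bij_inj S_bij.
Let Si := inverse S.
Let SiK : forall x, S (Si x) = x := inverseK.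
Let S_anticomul := antipode_anticomul.

Lemma inverse_antipode_linear : linear (inverse S).
Proof. by move=> a x y; apply: S_inj; rewrite S_lin !SiK. Qed.

Let Si_lin : linear Si := inverse_antipode_linear.

Lemma inverse_antipode1 : inverse S one = one.
Proof. by apply: S_inj; rewrite SiK antipode1. Qed.

Lemma inverse_antipode_mul x y : inverse S (x * y) = inverse S y * inverse S x.
Proof. by apply: S_inj; rewrite antipode_mul !SiK. Qed.

(** The inverse of the antipode is an antipode for the opposite coproduct: apply
    [S], which reverses products, and use the antipode identities. *)
Lemma inverse_antipodel x :
  \sw_(x1, x2 <- x) inverse S x2 * x1 = counit x *: one.
Proof.
apply: S_inj; rewrite (sw_hoist _ _ S_lin) (linZ S_lin) antipode1 -Sl.
by apply: eq_sw => a b; rewrite antipode_mul SiK.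
Qed.

Lemma inverse_antipoder x :
  \sw_(x1, x2 <- x) x2 * inverse S x1 = counit x *: one.
Proof.
apply: S_inj; rewrite (sw_hoist _ _ S_lin) (linZ S_lin) antipode1 -Sr.
by apply: eq_sw => a b; rewrite antipode_mul SiK.
Qed.

Lemma inverse_antipode_anticomul : anticomul1 (inverse S).
Proof.
split=> x; last by rewrite -[in RHS](SiK x) counit_antipode.
rewrite -[in RHS](SiK x) sw_anticomul1; [|exact: antipode_anticomul|rewrite -/Si; lin].
by rewrite comultE; apply: eq_sw => a b; rewrite !antipodeK.
Qed.

End HopfAlgebra.

(** * Exponentials *)

Section Exponential.
Variables (k : fieldType) (H : coalgType k) (dot : H -> H -> H).
Hypothesis dot_bil : is_bilinear dot.

(** The exponential is a two-sided inverse for a convolution, hence unique: for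
    two candidates [f] and [e], [f ((e h l1) · l2) l3] reduces to [f h l] and to
    [e h l]. *)
Lemma expoE e : is_exponential dot e -> expo dot = e.
Proof.
move=> eP; have [e_bil ee] := eP.
have [f_bil fe] : is_exponential dot (expo dot).
  exact: (@xgetPex _ _ [set f | is_exponential dot f] (ex_intro _ e eP)).
move: (expo dot) f_bil fe => f f_bil fe.
apply: funext => h; apply: funext => l.
transitivity (\sw_(l1, l2 <- l) f (counit l1 *: h) l2).
  sw [:: h; l].
transitivity (\sw_(l1, l' <- l) \sw_(l2, l3 <- l') f (dot (e h l1) l2) l3).
  symmetry; transitivity (\sw_(l1, l2 <- l) f (\sw_(a, b <- l1) dot (e h a) b) l2).
    sw [:: h; l].
  by apply: eq_sw => l1 l2; rewrite (ee h l1).2.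
transitivity (\sw_(l1, l2 <- l) (\sw_(a, b <- l2) f (dot (e h l1) a) b)); first by [].
swr ltac:(rewrite (fe _ _).1).
sw [:: h; l].
Qed.

End Exponential.

(** * From Hopf skew-braces to linear q-cycle coalgebras *)

Section SkewBraceToCycle.
Variables (k : fieldType) (H : coalgType k).
Variables (mul : H -> H -> H) (one : H) (S : H -> H) (dot colon : H -> H -> H).
Hypothesis brace : is_hopf_skew_brace mul one S dot colon.
Hypothesis S_bij : bijective S.
Local Notation "x * y" := (mul x y) : ring_scope.
Local Notation "x · y" := (dot x y) (at level 40, left associativity) : ring_scope.
Local Notation "x ∶ y" := (colon x y) (at level 40, left associativity) : ring_scope.

Let qbrace := brace.1.
Let hopf := hqb_hopf qbrace.
Let mul_bil := hopf_mul_bilinear hopf.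
Let S_lin := hopf_antipode_linear hopf.
Let one_gl := hopf_one_grouplike hopf.
Let mulA := hopf_mulA hopf.
Let mul1 := hopf_mul1l hopf.
Let mulr1 := hopf_mul1r hopf.
Let mul_comul := hopf_comul2 hopf.
Let Sl := hopf_antipodel hopf.
Let Sr := hopf_antipoder hopf.
Let S_anticomul := antipode_anticomul hopf.
Let Si := inverse S.
Let Si_lin : linear Si := inverse_antipode_linear hopf S_bij.
Let Sil x : \sw_(x1, x2 <- x) Si x2 * x1 = counit x *: one :=
  inverse_antipodel hopf S_bij x.
Let Sir x : \sw_(x1, x2 <- x) x2 * Si x1 = counit x *: one :=
  inverse_antipoder hopf S_bij x.
Let Si_anticomul : anticomul1 Si := inverse_antipode_anticomul hopf S_bij.
Let dot_bil := hqb_dot_bilinear qbrace.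
Let colon_bil := hqb_colon_bilinear qbrace.
Let dotM x y z : (x · y) · z = x · (z * y) := (hqb_dot_module qbrace).1 x y z.
Let dot1 x : x · one = x := (hqb_dot_module qbrace).2 x.
Let colonM x y z : (x ∶ y) ∶ z = x ∶ (z * y) := (hqb_colon_module qbrace).1 x y z.
Let colon1 x : x ∶ one = x := (hqb_colon_module qbrace).2 x.

Let braidingP x y : copl_comult (braiding dot colon x y) =
  \sw_(a, b <- x) \sw_(c, d <- y) braiding dot colon a d ⊗ braiding dot colon b c.
Proof. by have /coalg_morphism2_copl[_ cb _] := hqb_coalg qbrace; apply: cb. Qed.

Let counit_dot := hqb_counit_dot qbrace.
Let counit_colon := hqb_counit_colon qbrace.
Let dot_anticomul : anticomul2 dot.
Proof. exact: (braiding_anticomul_dot dot_bil counit_dot counit_colon braidingP). Qed.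
Let colon_anticomul : anticomul2 colon.
Proof. exact: (braiding_anticomul_colon colon_bil counit_dot counit_colon braidingP). Qed.
Let twisted : twisted_commute dot colon.
Proof. by apply: braiding_twisted_commute braidingP. Qed.

Let cross (h l : H) : H := \sw_(h1, h2 <- h) (l · h1) * h2.
Local Notation "x × y" := (cross x y) (at level 40, left associativity) : ring_scope.
Let crossE h l : h × l = \sw_(h1, h2 <- h) (l · h1) * h2 := erefl.
Let crossE' h l : h × l = \sw_(l1, l2 <- l) (h ∶ l2) * l1.
Proof. by rewrite brace.2. Qed.
Let cross_bil : is_bilinear cross.
Proof. by rewrite /cross; lin. Qed.

Lemma inverse_antipode_exponential : is_exponential dot (fun h l => h · Si l).
Proof.
split; first by lin.
move=> h l; split.
  transitivity (h · (\sw_(l1, l2 <- l) Si l2 * l1)).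
    sw_with [:: h; l] ltac:(rewrite ?dotM).
  rewrite Sil.
  sw_with [:: h; l] ltac:(rewrite ?dot1).
transitivity (h · (\sw_(l1, l2 <- l) l2 * Si l1)).
  sw_with [:: h; l] ltac:(rewrite ?dotM).
rewrite Sir.
sw_with [:: h; l] ltac:(rewrite ?dot1).
Qed.

Let expo_dot : expo dot = fun h l => h · Si l :=
  expoE dot_bil inverse_antipode_exponential.

Let T (h : H) : H := \sw_(h1, h2 <- h) expo dot (S h1) h2.

Let TE h : T h = \sw_(h1, h2 <- h) S h1 · Si h2.
Proof. by rewrite /T expo_dot. Qed.

Let T_lin : linear T.
Proof. by rewrite /T expo_dot; lin. Qed.

Lemma lqc_mulE : lqc_mul cross dot = mul.
Proof.
apply: funext => h; apply: funext => m; rewrite /lqc_mul expo_dot.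
rewrite /cross.
transitivity (\sw_(m1, m2 <- m) (h · (\sw_(a, b <- m1) b * Si a)) * m2).
  sw_with [:: h; m] ltac:(rewrite ?dotM).
swr ltac:(rewrite Sir).
sw_with [:: h; m] ltac:(rewrite ?dot1).
Qed.

Lemma lqc_antipodeE : lqc_antipode T dot = S.
Proof.
apply: funext => h; rewrite /lqc_antipode.
transitivity (\sw_(h1, h2 <- h) (\sw_(a, b <- h1) S a · Si b) · h2).
  by apply: eq_sw => a b; rewrite TE.
transitivity (\sw_(h1, h2 <- h) S h1 · (\sw_(a, b <- h2) b * Si a)).
  sw_with [:: h] ltac:(rewrite ?dotM).
swr ltac:(rewrite Sir).
sw_with [:: h] ltac:(rewrite ?dot1).
Qed.

(** The map [f l = one · l] is idempotent for convolution, as [one * one = one],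
    and it reverses coproducts, so that [Si] composed with it is a convolution
    inverse; hence it is the neutral element. *)
Let one_dot l : one · l = counit l *: one.
Proof.
pose f l := one · l; have f_lin : linear f by rewrite /f; lin.
have f_anti : anticomul1 f.
  split=> [x|x]; rewrite /f; last by rewrite dot_anticomul.2 one_gl.2 GRing.mul1r.
  rewrite dot_anticomul.1 sw_grouplike //; lin.
have fM x : f x = \sw_(x1, x2 <- x) f x1 * f x2.
  rewrite {1}/f -{1}[one]mul1 (hqb_mul_dot qbrace) sw_grouplike //; last by lin.
  by apply: eq_sw => x1 x2; rewrite colon1.
rewrite -/(f l).
transitivity (\sw_(l1, l2 <- l) counit l1 *: (one * f l2)).
  sw_with [:: l] ltac:(rewrite ?mul1).
transitivity (\sw_(l1, l2 <- l) (\sw_(a, b <- f l1) Si b * a) * f l2).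
  symmetry; swr ltac:(rewrite Sil f_anti.2).
  sw [:: l].
transitivity (\sw_(l1, l2 <- l) Si (f l1) * (\sw_(a, b <- l2) f a * f b)).
  sw_with [:: l] ltac:(rewrite -?mulA).
transitivity (\sw_(l1, l2 <- l) Si (f l1) * f l2).
  by apply: eq_sw => a b; rewrite -fM.
transitivity (\sw_(a, b <- f l) Si b * a).
  sw [:: l].
by rewrite Sil f_anti.2.
Qed.

Let cross1 l : one × l = l.
Proof. rewrite /cross sw_grouplike //; [by rewrite dot1 mulr1 | lin]. Qed.

Let crossr1 l : l × one = l.
Proof.
rewrite /cross; swr ltac:(rewrite one_dot).
sw_with [:: l] ltac:(rewrite ?mul1).
Qed.

(** Both bracketings are equal to [(m · (h2 × l1)) * ((l2 · h1) * h3)], a form in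
    which [h × l] is seen once through [·] and once through [∶]. *)
Let crossA : associative cross.
Proof.
move=> h l m.
transitivity (\sw_(h1, h' <- h) \sw_(h2, h3 <- h') \sw_(l1, l2 <- l)
   (m · (h2 × l1)) * ((l2 · h1) * h3)).
  transitivity (\sw_(h1, h2 <- h) \sw_(l1, l2 <- l)
     (((m · l1) * l2) · h1) * h2).
    rewrite /cross; sw [:: h; l; m].
  swr ltac:(rewrite (hqb_mul_dot qbrace)).
  transitivity (\sw_(h1, h2 <- h) \sw_(l1, l2 <- l)
     (\sw_(a1, a2 <- h1) \sw_(b1, b2 <- l2) (m · ((a1 ∶ b2) * l1)) * ((b1 · a2) * h2))).
    sw_with [:: h; l; m] ltac:(rewrite ?dotM -?mulA).
  transitivity (\sw_(h1, h2 <- h) \sw_(l1, l2 <- l)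
     (\sw_(a1, a2 <- h1) \sw_(b1, b2 <- l2) (m · ((a2 ∶ b1) * l1)) * ((b2 · a1) * h2))).
    apply: eq_sw => h1 h2; apply: eq_sw => l1 l2.
    rewrite sw_exchange [RHS]sw_exchange; symmetry.
    apply: (twisted_commuteE (f := fun u v => (m · (u * l1)) * (v * h2)) twisted); lin.
  symmetry; swr ltac:(rewrite crossE').
  sw [:: h; l; m].
rewrite /cross; sw_with [:: h; l; m] ltac:(rewrite -?mulA).
Qed.

Let cross_dot h m l : (m × l) · h = \sw_(h1, h2 <- h) (m · h1) × (l · h2).
Proof.
transitivity (\sw_(m1, m2 <- m) ((l · m1) * m2) · h).
  rewrite /cross; sw [:: h; m; l].
swr ltac:(rewrite (hqb_mul_dot qbrace)).
transitivity (\sw_(m1, m2 <- m) \sw_(a1, a2 <- h) \sw_(b1, b2 <- m2)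
   ((l · m1) · (a2 ∶ b1)) * (b2 · a1)).
  apply: eq_sw => m1 m2.
  rewrite [RHS]sw_exchange; symmetry.
  apply: (twisted_commuteE (f := fun u v => ((l · m1) · u) * v) twisted); lin.
transitivity (\sw_(m1, m2 <- m) \sw_(h1, h2 <- h)
   (\sw_(a, b <- m1) (l · a) · (h2 ∶ b)) * (m2 · h1)).
  sw [:: h; m; l].
swr ltac:(rewrite (hqb_cycle1 qbrace)).
rewrite /cross; sw [:: h; m; l].
Qed.

Let dot_cross h m l : h · (m × l) = \sw_(m1, m2 <- m) (h · m2) · (l · m1).
Proof.
rewrite crossE' -(hqb_cycle1 qbrace).
sw_with [:: h; m; l] ltac:(rewrite ?dotM).
Qed.

Let T_right h : \sw_(h1, h2 <- h) h2 × T h1 = counit h *: one.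
Proof.
transitivity (\sw_(h1, h2 <- h) (lqc_antipode T dot h1) * h2).
  rewrite /lqc_antipode /cross; sw [:: h].
by rewrite lqc_antipodeE Sl.
Qed.

(** The counterpart of [T] for the action [∶].  It is a left inverse of the
    identity for the convolution of which [T] is a right inverse, so [T' = T]. *)
Let T' (h : H) : H := \sw_(h1, h2 <- h) Si h2 ∶ S h1.

Let T'_lin : linear T'.
Proof. by rewrite /T'; lin. Qed.

Let T'_left h : \sw_(h1, h2 <- h) T' h2 × h1 = counit h *: one.
Proof.
rewrite -Sil; swr ltac:(rewrite crossE').
transitivity (\sw_(h1, h' <- h) \sw_(h2, h3 <- h')
    (Si h3 ∶ (\sw_(a, b <- h2) a * S b)) * h1).
  rewrite /T'; sw_with [:: h] ltac:(rewrite ?colonM).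
swr ltac:(rewrite Sr).
sw_with [:: h] ltac:(rewrite ?colon1).
Qed.

Let TT' h : T h = T' h.
Proof.
transitivity (\sw_(h1, h2 <- h) (\sw_(a, b <- h2) T' b × a) × T h1).
  symmetry; swr ltac:(rewrite T'_left).
  sw_with [:: h] ltac:(rewrite ?cross1).
transitivity (\sw_(h1, h2 <- h) T' h2 × (\sw_(a, b <- h1) b × T a)).
  sw_with [:: h] ltac:(rewrite -?crossA).
swr ltac:(rewrite T_right).
sw_with [:: h] ltac:(rewrite ?crossr1).
Qed.

Let T_left h : \sw_(h1, h2 <- h) T h2 × h1 = counit h *: one.
Proof. by rewrite -T'_left; apply: eq_sw => a b; rewrite TT'. Qed.

(** The map that has to be a coalgebra morphism in a linear q-cycle coalgebra is
    the second action of the skew-brace. *)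
Let colonE h m : h ∶ m = \sw_(h1, h2 <- h) \sw_(m1, m2 <- m) ((m2 · h1) * h2) * Si m1.
Proof.
symmetry; transitivity (\sw_(m1, m2 <- m) (h × m2) * Si m1).
  rewrite /cross; sw [:: h; m].
swr ltac:(rewrite crossE').
transitivity (\sw_(m1, m2 <- m) (h ∶ m2) * (\sw_(a, b <- m1) b * Si a)).
  sw_with [:: h; m] ltac:(rewrite -?mulA).
swr ltac:(rewrite Sir).
sw_with [:: h; m] ltac:(rewrite ?mulr1).
Qed.

Lemma skew_brace_cycle_coalgebra :
  (forall h, T h = \sw_(h1, h2 <- h) S h1 · Si h2) /\
  is_linear_q_cycle_coalgebra cross T dot one.
Proof.
split; first exact: TE.
split; rewrite ?lqc_mulE ?lqc_antipodeE //.
- exact/coalg_morphism2_anticomul.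
- by eexists; apply: inverse_antipode_exponential.
- exact/coalg_morphism2_comul.
- exact/coalg_morphism_anticomul.
apply/coalg_morphism2_anticomul.
have -> : (fun h m : H => \sw_(h1, h2 <- h) \sw_(m1, m2 <- m)
    ((m2 · h1) * h2) * inverse S m1) = colon.
  by apply: funext => h; apply: funext => m; rewrite colonE.
by [].
Qed.

End SkewBraceToCycle.

(** * From linear q-cycle coalgebras to GV-Hopf skew-braces *)

Section CycleToGV.
Variables (k : fieldType) (H : coalgType k).
Variables (cross : H -> H -> H) (T : H -> H) (dot : H -> H -> H) (one : H).
Hypothesis cycle : is_linear_q_cycle_coalgebra cross T dot one.
Local Notation "x · y" := (dot x y) (at level 40, left associativity) : ring_scope.
Local Notation "x × y" := (cross x y) (at level 40, left associativity) : ring_scope.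

Let one_gl := lqc_grouplike cycle.
Let cross_bil := lqc_cross_bilinear cycle.
Let crossA := lqc_crossA cycle.
Let cross1 := lqc_cross1l cycle.
Let crossr1 := lqc_cross1r cycle.
Let T_lin := lqc_T_linear cycle.
Let dot_bil : is_bilinear dot := proj1 (lqc_dot_coalg cycle).
Let dot_anticomul : anticomul2 dot.
Proof. by have /coalg_morphism2_anticomul[] := lqc_dot_coalg cycle. Qed.

Let e := expo dot.
Let e_exp : is_exponential dot e.
Proof. by have [f fP] := lqc_expo cycle; rewrite /e (expoE dot_bil fP). Qed.
Let e_bil : is_bilinear e := e_exp.1.
Let e_dot h l : \sw_(l1, l2 <- l) e (h · l1) l2 = counit l *: h := (e_exp.2 h l).1.
Let dot_e h l : \sw_(l1, l2 <- l) e h l1 · l2 = counit l *: h := (e_exp.2 h l).2.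

Let mul (h l : H) : H := \sw_(l1, l2 <- l) l2 × e h l1.
Let S (h : H) : H := \sw_(h1, h2 <- h) T h1 · h2.
Local Notation "x * y" := (mul x y) : ring_scope.

Let mul_bil : is_bilinear mul.
Proof. by rewrite /mul; lin. Qed.
Let mul_comul : comul2 mul.
Proof. by have /coalg_morphism2_comul[] := lqc_mul_coalg cycle. Qed.
Let S_lin : linear S.
Proof. by rewrite /S; lin. Qed.
Let S_anticomul : anticomul1 S.
Proof. by have /coalg_morphism_anticomul[] := lqc_antipode_coalg cycle. Qed.

(** All formulas for the exponential below are obtained from this criterion or by
    the same cancellation. *)
Let e_unique (R : H -> H) x : linear R ->
  (forall h, \sw_(h1, h2 <- h) R h1 · h2 = counit h *: x) ->
  forall h, R h = e x h.
Proof.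
move=> R_lin RP h.
transitivity (\sw_(h1, h2 <- h) (\sw_(a, b <- h2) e (R h1 · a) b)).
  symmetry; swr ltac:(rewrite e_dot).
  sw [:: h].
transitivity (\sw_(h1, h2 <- h) e (\sw_(a, b <- h1) R a · b) h2).
  sw [:: h].
swr ltac:(rewrite RP).
sw [:: h].
Qed.

Let cross_mul h l : \sw_(h1, h2 <- h) (l · h1) * h2 = h × l.
Proof.
transitivity (\sw_(h1, h2 <- h) h2 × (\sw_(a, b <- h1) e (l · a) b)).
  rewrite /mul; sw [:: h; l].
swr ltac:(rewrite e_dot).
sw [:: h; l].
Qed.

Let cross_dot h m l : (m × l) · h = \sw_(h1, h2 <- h) (m · h1) × (l · h2) :=
  lqc_dot_crossl cycle h m l.
Let dot_cross h m l : h · (m × l) = \sw_(m1, m2 <- m) (h · m2) · (l · m1) :=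
  lqc_dot_crossr cycle h m l.

(** By the distributivity of [·] over [×],
    [(one^h1 · h2) × (one · h3) = one^h1 · h2], and both sides collapse. *)
Let one_dot h : one · h = counit h *: one.
Proof.
rewrite -[LHS]cross1.
transitivity (\sw_(h1, h2 <- h) (counit h1 *: one) × (one · h2)).
  sw [:: h].
transitivity (\sw_(h1, h2 <- h) (\sw_(a, b <- h1) e one a · b) × (one · h2)).
  symmetry; swr ltac:(rewrite dot_e).
  by [].
transitivity (\sw_(h1, h2 <- h) (\sw_(a, b <- h2) (e one h1 · a) × (one · b))).
  sw [:: h].
swr ltac:(rewrite -cross_dot crossr1).
exact: dot_e.
Qed.

Let e_one x : e (x · one) one = x.
Proof. by have := e_dot x one; rewrite sw_grouplike ?counit_grouplike //; lin. Qed.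

Let one_e x : e x one · one = x.
Proof. by have := dot_e x one; rewrite sw_grouplike ?counit_grouplike //; lin. Qed.

Let dot1 x : x · one = x.
Proof.
have := dot_cross (e x one) one one.
rewrite cross1 sw_grouplike //; last by lin.
by rewrite !one_e one_dot counit_grouplike // => <-.
Qed.

Let e1 x : e x one = x.
Proof. by rewrite -{1}[x]dot1 e_one. Qed.

Let one_el h : e one h = counit h *: one.
Proof.
symmetry; apply: (e_unique (R := fun h => counit h *: one)); first by lin.
by move=> l; transitivity (one · l); [sw [:: l] | apply: one_dot].
Qed.

Let mul1 : left_id one mul.
Proof.
move=> h; rewrite /mul; swr ltac:(rewrite one_el).
sw_with [:: h] ltac:(rewrite ?crossr1).
Qed.

Let mulr1 : right_id one mul.
Proof.
by move=> h; rewrite /mul sw_grouplike //; [rewrite cross1 e1 | lin].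
Qed.

Let dotM x y z : x · (y * z) = (x · z) · y.
Proof.
transitivity (\sw_(z1, z2 <- z) x · (z2 × e y z1)).
  rewrite /mul; sw [:: x; y; z].
swr ltac:(rewrite dot_cross).
transitivity (\sw_(z1, z2 <- z) (x · z2) · (\sw_(a, b <- z1) e y a · b)).
  sw [:: x; y; z].
swr ltac:(rewrite dot_e).
sw [:: x; y; z].
Qed.

Let e_cross m l h : e (m × l) h = \sw_(h1, h2 <- h) e m h2 × e l h1.
Proof.
symmetry; apply: (e_unique (R := fun h => \sw_(h1, h2 <- h) e m h2 × e l h1)).
  by lin.
move=> {}h.
transitivity (\sw_(h1, h2 <- h) \sw_(a, b <- h1) (e m b × e l a) · h2).
  sw [:: m; l; h].
swr ltac:(rewrite cross_dot).
transitivity (\sw_(h1, h' <- h) \sw_(h2, h3 <- h')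
   (\sw_(a, b <- h2) e m a · b) × (e l h1 · h3)).
  sw [:: m; l; h].
swr ltac:(rewrite dot_e).
transitivity (m × (\sw_(a, b <- h) e l a · b)).
  sw [:: m; l; h].
rewrite dot_e; sw [:: m; l; h].
Qed.

(** Insert [(a^(b1 * c1)) · (b2 * c2)], which is a scalar multiple of [a], in the
    right-hand side; since it is also [((a^(b1 * c1)) · c2) · b2], the two outer
    exponentials cancel. *)
Let e_mul a b c : e a (b * c) = e (e a b) c.
Proof.
symmetry; transitivity (\sw_(b1, b2 <- b) \sw_(c1, c2 <- c)
    e (e (\sw_(u, v <- b1 * c1) e a u · v) b2) c2).
  symmetry; swr ltac:(rewrite dot_e).
  sw [:: a; b; c].
transitivity (\sw_(b1, b2 <- b) \sw_(c1, c' <- c) \sw_(c2, c3 <- c')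
    e (\sw_(u, v <- b2) e ((e a (b1 * c1) · c2) · u) v) c3).
  sw_with [:: a; b; c] ltac:(rewrite ?dotM).
swr ltac:(rewrite e_dot).
transitivity (\sw_(c1, c2 <- c) \sw_(u, v <- c2) e (e a (b * c1) · u) v).
  sw [:: a; b; c].
swr ltac:(rewrite e_dot).
sw [:: a; b; c].
Qed.

Let mulA : associative mul.
Proof.
move=> a b c.
transitivity (\sw_(b1, b2 <- b) \sw_(c1, c2 <- c) (b2 * c2) × e (e a b1) c1).
  transitivity (\sw_(u, v <- b * c) v × e a u).
    by [].
  sw_with [:: a; b; c] ltac:(rewrite ?e_mul).
symmetry; transitivity (\sw_(b1, b2 <- b) \sw_(c1, c2 <- c) c2 × e (b2 × e a b1) c1).
  rewrite /mul; sw [:: a; b; c].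
swr ltac:(rewrite e_cross).
rewrite /mul; sw_with [:: a; b; c] ltac:(rewrite -?crossA).
Qed.

Let S_left h : \sw_(h1, h2 <- h) S h1 * h2 = counit h *: one.
Proof.
rewrite -(lqc_Tr cycle); symmetry; swr ltac:(rewrite -cross_mul).
rewrite /S; sw [:: h].
Qed.

(** Exponentiating by [S h] undoes the action of [S h], and the action of [S h1]
    undoes that of [h2]. *)
Let e_S x h : e x (S h) = x · h.
Proof.
transitivity (\sw_(h1, h2 <- h) e (x · (\sw_(a, b <- h2) S a * b)) (S h1)).
  symmetry; swr ltac:(rewrite S_left).
  sw_with [:: x; h] ltac:(rewrite ?dot1).
transitivity (\sw_(h1, h2 <- h) \sw_(u, v <- S h1) e ((x · h2) · u) v).
  sw_with [:: x; h] ltac:(rewrite ?dotM).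
swr ltac:(rewrite e_dot).
sw [:: x; h].
Qed.

(** By [e_S], [h1 * S h2 = S h2 × (h1 · h3)], which is [(T h2 × h1) · h3] by the
    distributivity of [·] over [×]. *)
Let S_right h : \sw_(h1, h2 <- h) h1 * S h2 = counit h *: one.
Proof.
transitivity (\sw_(h1, h2 <- h) \sw_(u, v <- S h2) v × e h1 u).
  by [].
transitivity (\sw_(h1, h' <- h) \sw_(h2, h3 <- h') S h2 × (h1 · h3)).
  sw_with [:: h] ltac:(rewrite ?e_S).
transitivity (\sw_(h1, h2 <- h) (\sw_(a, b <- h1) (T b × a)) · h2).
  symmetry; transitivity (\sw_(h1, h2 <- h) \sw_(a, b <- h1) ((T b × a) · h2)).
    sw [:: h].
  swr ltac:(rewrite cross_dot).
  rewrite /S; sw [:: h].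
swr ltac:(rewrite (lqc_Tl cycle)).
transitivity (one · h); last exact: one_dot.
sw [:: h].
Qed.

Lemma cycle_coalgebra_hopf : is_hopf_algebra mul one S.
Proof. by split=> //; apply: lqc_mul_coalg cycle. Qed.

Let cross_mulE h m l : (m × l) * h =
  \sw_(h1, h' <- h) \sw_(h2, h3 <- h') ((m * h3) × T h2) × (l * h1).
Proof.
transitivity (\sw_(h1, h2 <- h) h2 × e (m × l) h1).
  by [].
swr ltac:(rewrite e_cross).
symmetry; transitivity (\sw_(h1, h' <- h) \sw_(h2, h3 <- h')
  (m * h3) × ((\sw_(a, b <- h2) T b × a) × e l h1)).
  rewrite /mul; sw_with [:: h; m; l] ltac:(rewrite -?crossA).
swr ltac:(rewrite (lqc_Tl cycle)).
rewrite /mul; sw_with [:: h; m; l] ltac:(rewrite ?cross1 -?crossA).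
Qed.

Let gv_dotE : gv_dot mul S cross = dot.
Proof.
apply: funext => h; apply: funext => m; rewrite /gv_dot.
swr ltac:(rewrite -cross_mul).
transitivity (\sw_(m1, m2 <- m) (h · m1) * (\sw_(a, b <- m2) a * S b)).
  sw_with [:: h; m] ltac:(rewrite -?mulA).
swr ltac:(rewrite S_right).
sw_with [:: h; m] ltac:(rewrite ?mulr1).
Qed.

Let gv_colonE : gv_colon mul S cross =
  (fun h m : H => \sw_(h1, h2 <- h) \sw_(m1, m2 <- m) ((m2 · h1) * h2) * inverse S m1).
Proof.
have Si_lin : linear (inverse S).
  by apply: (inverse_antipode_linear cycle_coalgebra_hopf); apply: lqc_antipode_bij cycle.
apply: funext => h; apply: funext => m; rewrite /gv_colon.
move: (inverse S) Si_lin => Si Si_lin.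
swr ltac:(rewrite -cross_mul).
sw [:: h; m].
Qed.

Lemma cycle_coalgebra_gv : is_gv_hopf_skew_brace mul one S cross T.
Proof.
split=> //.
- exact: cycle_coalgebra_hopf.
- exact: lqc_antipode_bij cycle.
- by rewrite gv_dotE; apply: lqc_dot_coalg cycle.
- by rewrite gv_colonE; apply: lqc_colon_coalg cycle.
Qed.

End CycleToGV.

(** * From GV-Hopf skew-braces to Hopf skew-braces *)

Section GVToSkewBrace.
Variables (k : fieldType) (H : coalgType k).
Variables (mul : H -> H -> H) (one : H) (S : H -> H) (cross : H -> H -> H) (T : H -> H).
Hypothesis gv : is_gv_hopf_skew_brace mul one S cross T.
Local Notation "x * y" := (mul x y) : ring_scope.
Local Notation "x × y" := (cross x y) (at level 40, left associativity) : ring_scope.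

Let hopf := gv_hopf gv.
Let S_bij := gv_antipode_bij gv.
Let mul_bil := hopf_mul_bilinear hopf.
Let S_lin := hopf_antipode_linear hopf.
Let one_gl := hopf_one_grouplike hopf.
Let mulA := hopf_mulA hopf.
Let mul1 := hopf_mul1l hopf.
Let mulr1 := hopf_mul1r hopf.
Let mul_comul := hopf_comul2 hopf.
Let Sl := hopf_antipodel hopf.
Let Sr := hopf_antipoder hopf.
Let SM := antipode_mul hopf.
Let S_anticomul := antipode_anticomul hopf.
Let Si := inverse S.
Let Si_lin : linear Si := inverse_antipode_linear hopf S_bij.
Let Sil x : \sw_(x1, x2 <- x) Si x2 * x1 = counit x *: one :=
  inverse_antipodel hopf S_bij x.
Let Sir x : \sw_(x1, x2 <- x) x2 * Si x1 = counit x *: one :=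
  inverse_antipoder hopf S_bij x.
Let SiM x y : Si (x * y) = Si y * Si x := inverse_antipode_mul hopf S_bij x y.
Let Si_anticomul : anticomul1 Si := inverse_antipode_anticomul hopf S_bij.
Let cross_bil := gv_cross_bilinear gv.
Let T_lin := gv_T_linear gv.
Let crossA := gv_crossA gv.
Let cross1 := gv_cross1l gv.
Let crossr1 := gv_cross1r gv.
Let cross_mul := gv_cross_mul gv.

Let dot (h l : H) : H := \sw_(l1, l2 <- l) (l1 × h) * S l2.
Let colon (h l : H) : H := \sw_(l1, l2 <- l) (h × l2) * Si l1.
Local Notation "x · y" := (dot x y) (at level 40, left associativity) : ring_scope.
Local Notation "x ∶ y" := (colon x y) (at level 40, left associativity) : ring_scope.

Let dot_bil : is_bilinear dot := (gv_dot_coalg gv).1.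
Let colon_bil : is_bilinear colon := (gv_colon_coalg gv).1.
Let dot_anticomul : anticomul2 dot.
Proof. by have /coalg_morphism2_anticomul[] := gv_dot_coalg gv. Qed.
Let colon_anticomul : anticomul2 colon.
Proof. by have /coalg_morphism2_anticomul[] := gv_colon_coalg gv. Qed.

(** The axiom for [(m × l) * h] does not say that [T] is an inverse for [×]; this
    follows by taking [m = one] and [l = S h1], where its left-hand side is
    [S h1 * h2]. *)
Let T_right h : \sw_(h1, h2 <- h) h2 × T h1 = counit h *: one.
Proof.
rewrite -Sl; symmetry.
transitivity (\sw_(h1, h2 <- h) (one × S h1) * h2).
  by apply: eq_sw => h1 h2; rewrite cross1.
swr ltac:(rewrite cross_mul).
transitivity (\sw_(h1, h2 <- h) (h2 × T h1) × one); last first.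
  by apply: eq_sw => h1 h2; rewrite crossr1.
transitivity (\sw_(h1, h' <- h) \sw_(h2, h3 <- h')
    (h3 × T h2) × (\sw_(a, b <- h1) S a * b)).
  sw_with [:: h] ltac:(rewrite ?mul1).
swr ltac:(rewrite Sl).
sw [:: h].
Qed.

(** The same with [m = Si h2] and [l = one]. *)
Let T_left h : \sw_(h1, h2 <- h) T h2 × h1 = counit h *: one.
Proof.
rewrite -Sil; symmetry.
transitivity (\sw_(h1, h2 <- h) (Si h2 × one) * h1).
  by apply: eq_sw => h1 h2; rewrite crossr1.
swr ltac:(rewrite cross_mul).
transitivity (\sw_(h1, h' <- h) \sw_(h2, h3 <- h')
    ((\sw_(a, b <- h3) Si b * a) × T h2) × h1).
  sw_with [:: h] ltac:(rewrite ?mul1).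
swr ltac:(rewrite Sil).
sw_with [:: h] ltac:(rewrite ?cross1).
Qed.

(** For [z = one] this is a second formula for [x · y]; for [z] general it says
    that [z × (x · y)] can be computed from [z * y1], which is what the module
    axiom needs. *)
Let dot_shift z x y : \sw_(y1, y2 <- y) ((z * y1) × x) * S y2 =
  z × (\sw_(y1, y2 <- y) T (S y1) × (x * S y2)).
Proof.
swr ltac:(rewrite cross_mul).
transitivity (\sw_(y1, y2 <- y) ((z * (\sw_(a, b <- y1) a * S b)) ×
    (\sw_(a, b <- y2) T (S a) × (x * S b)))).
  sw_with [:: x; y; z] ltac:(rewrite -?mulA -?crossA).
swr ltac:(rewrite Sr).
sw_with [:: x; y; z] ltac:(rewrite ?mulr1).
Qed.

Let dotE x y : x · y = \sw_(y1, y2 <- y) T (S y1) × (x * S y2).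
Proof.
rewrite -[RHS]cross1 -dot_shift.
by apply: eq_sw => a b; rewrite mul1.
Qed.

Let dotM x y z : (x · y) · z = x · (z * y).
Proof.
transitivity (\sw_(z1, z2 <- z) (z1 × (x · y)) * S z2); first by [].
transitivity (\sw_(z1, z2 <- z) (\sw_(y1, y2 <- y) ((z1 * y1) × x) * S y2) * S z2).
  by apply: eq_sw => z1 z2; rewrite dot_shift dotE.
rewrite /dot; sw_with [:: x; y; z] ltac:(rewrite ?SM -?mulA).
Qed.

Let dot1 x : x · one = x.
Proof.
rewrite /dot sw_grouplike //; last by lin.
by rewrite cross1 (antipode1 hopf) mulr1.
Qed.

Let colon_shift z x y : \sw_(y1, y2 <- y) (x × (z * y2)) * Si y1 =
  (\sw_(y1, y2 <- y) (x * Si y1) × T (Si y2)) × z.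
Proof.
swr ltac:(rewrite cross_mul).
transitivity (\sw_(y1, y2 <- y) (\sw_(a, b <- y1) (x * Si a) × T (Si b)) ×
    (z * (\sw_(a, b <- y2) b * Si a))).
  sw_with [:: x; y; z] ltac:(rewrite -?mulA -?crossA).
swr ltac:(rewrite Sir).
sw_with [:: x; y; z] ltac:(rewrite ?mulr1).
Qed.

Let colonE x y : x ∶ y = \sw_(y1, y2 <- y) (x * Si y1) × T (Si y2).
Proof.
rewrite -[RHS]crossr1 -colon_shift.
by apply: eq_sw => a b; rewrite mul1.
Qed.

Let colonM x y z : (x ∶ y) ∶ z = x ∶ (z * y).
Proof.
transitivity (\sw_(z1, z2 <- z) ((x ∶ y) × z2) * Si z1); first by [].
transitivity (\sw_(z1, z2 <- z) (\sw_(y1, y2 <- y) (x × (z2 * y2)) * Si y1) * Si z1).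
  by apply: eq_sw => z1 z2; rewrite colon_shift colonE.
rewrite /colon; sw_with [:: x; y; z] ltac:(rewrite ?SiM -?mulA).
Qed.

Let colon1 x : x ∶ one = x.
Proof.
rewrite /colon sw_grouplike //; last by lin.
by rewrite crossr1 /Si (inverse_antipode1 hopf) // mulr1.
Qed.

Let crossE h l : \sw_(h1, h2 <- h) (l · h1) * h2 = h × l.
Proof.
transitivity (\sw_(h1, h2 <- h) (h1 × l) * (\sw_(a, b <- h2) S a * b)).
  rewrite /dot; sw_with [:: h; l] ltac:(rewrite -?mulA).
swr ltac:(rewrite Sl).
sw_with [:: h; l] ltac:(rewrite ?mulr1).
Qed.

Let crossE' h l : \sw_(l1, l2 <- l) (h ∶ l2) * l1 = h × l.
Proof.
transitivity (\sw_(l1, l2 <- l) (h × l2) * (\sw_(a, b <- l1) Si b * a)).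
  rewrite /colon; sw_with [:: h; l] ltac:(rewrite -?mulA).
swr ltac:(rewrite Sil).
sw_with [:: h; l] ltac:(rewrite ?mulr1).
Qed.

(** Both sides result from the coproduct of [y1 × x2] by multiplying its first
    factor by [Si x1] and its second one by [S y2]: write [y1 × x2] as
    [(x2 · a) * b] for one side, as [(y1 ∶ b) * a] for the other. *)
Let twisted : twisted_commute dot colon.
Proof.
move=> x y.
transitivity (\sw_(x1, x2 <- x) \sw_(y1, y2 <- y) \sw_(u, v <- y1 × x2)
    (u * Si x1) ⊗ (v * S y2)).
  symmetry.
  transitivity (\sw_(x1, x2 <- x) \sw_(y1, y2 <- y)
      \sw_(u, v <- \sw_(a, b <- y1) (x2 · a) * b) (u * Si x1) ⊗ (v * S y2)).
    by apply: eq_sw => ? ?; apply: eq_sw => ? ?; rewrite crossE.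
  transitivity (\sw_(x1, x' <- x) \sw_(x2, x3 <- x') \sw_(y1, y' <- y) \sw_(y2, y3 <- y')
      ((\sw_(a, b <- y2) (x2 · a) * b) * Si x1) ⊗
      ((x3 · y1) * (\sw_(a, b <- y3) a * S b))).
    sw_with [:: x; y] ltac:(rewrite -?mulA).
  swr ltac:(rewrite crossE Sr -crossE').
  transitivity (\sw_(x1, x' <- x) \sw_(x2, x3 <- x') \sw_(y1, y2 <- y)
      ((y2 ∶ x2) * (\sw_(a, b <- x1) b * Si a)) ⊗ (x3 · y1)).
    sw_with [:: x; y] ltac:(rewrite -?mulA ?mulr1).
  swr ltac:(rewrite Sir).
  sw_with [:: x; y] ltac:(rewrite ?mulr1).
transitivity (\sw_(x1, x2 <- x) \sw_(y1, y2 <- y)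
    \sw_(u, v <- \sw_(a, b <- x2) (y1 ∶ b) * a) (u * Si x1) ⊗ (v * S y2)).
  by apply: eq_sw => ? ?; apply: eq_sw => ? ?; rewrite crossE'.
transitivity (\sw_(x1, x' <- x) \sw_(x2, x3 <- x') \sw_(y1, y' <- y) \sw_(y2, y3 <- y')
    ((y1 ∶ x3) * (\sw_(a, b <- x1) b * Si a)) ⊗ ((\sw_(a, b <- x2) (y2 ∶ b) * a) * S y3)).
  sw_with [:: x; y] ltac:(rewrite -?mulA).
swr ltac:(rewrite crossE' Sir -crossE).
transitivity (\sw_(x1, x2 <- x) \sw_(y1, y' <- y) \sw_(y2, y3 <- y')
    (y1 ∶ x2) ⊗ ((x1 · y2) * (\sw_(a, b <- y3) a * S b))).
  sw_with [:: x; y] ltac:(rewrite -?mulA ?mulr1).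
swr ltac:(rewrite Sr).
sw_with [:: x; y] ltac:(rewrite ?mulr1).
Qed.

(** An identity between linear functions of [l] may be proved after multiplying
    by a further leg of [l] on the right, taken after the leg used by the
    function or, in the next lemma, before it. *)
Let cancel_right (F G : H -> H) : linear F -> linear G ->
  (forall l, \sw_(l1, l2 <- l) F l1 * l2 = \sw_(l1, l2 <- l) G l1 * l2) -> F =1 G.
Proof.
have E (F' : H -> H) l : linear F' ->
    F' l = \sw_(l1, l2 <- l) (\sw_(a, b <- l1) F' a * b) * S l2.
  move=> lF; symmetry.
  transitivity (\sw_(l1, l2 <- l) F' l1 * (\sw_(a, b <- l2) a * S b)).
    sw_with [:: l] ltac:(rewrite -?mulA).
  swr ltac:(rewrite Sr).
  sw_with [:: l] ltac:(rewrite ?mulr1).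
move=> lF lG FG l; rewrite (E F) // (E G) //.
by apply: eq_sw => a b; rewrite FG.
Qed.

Let cancel_right' (F G : H -> H) : linear F -> linear G ->
  (forall l, \sw_(l1, l2 <- l) F l2 * l1 = \sw_(l1, l2 <- l) G l2 * l1) -> F =1 G.
Proof.
have E (F' : H -> H) l : linear F' ->
    F' l = \sw_(l1, l2 <- l) (\sw_(a, b <- l2) F' b * a) * Si l1.
  move=> lF; symmetry.
  transitivity (\sw_(l1, l2 <- l) F' l2 * (\sw_(a, b <- l1) b * Si a)).
    sw_with [:: l] ltac:(rewrite -?mulA).
  swr ltac:(rewrite Sir).
  sw_with [:: l] ltac:(rewrite ?mulr1).
move=> lF lG FG l; rewrite (E F) // (E G) //.
by apply: eq_sw => a b; rewrite FG.
Qed.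

(** After multiplication by a leg of [l], both sides become [l × (h * m)]. *)
Let mul_dot h m l : (h * m) · l =
  \sw_(m1, m2 <- m) \sw_(l1, l2 <- l) (h · (l1 ∶ m2)) * (m1 · l2).
Proof.
move: l; apply: cancel_right; [by lin | by lin | move=> l].
rewrite crossE; symmetry.
transitivity (\sw_(m1, m2 <- m) \sw_(l1, l2 <- l)
    (h · (l1 ∶ m2)) * (\sw_(a, b <- l2) (m1 · a) * b)).
  sw_with [:: h; m; l] ltac:(rewrite -?mulA).
swr ltac:(rewrite crossE -crossE').
transitivity (\sw_(m1, m2 <- m) (\sw_(u, v <- l ∶ m2) (h · u) * v) * m1).
  sw_with [:: h; m; l] ltac:(rewrite -?mulA).
swr ltac:(rewrite crossE cross_mul).
transitivity (\sw_(m1, m' <- m) \sw_(m2, m3 <- m')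
    ((\sw_(a, b <- m3) (l ∶ b) * a) × T m2) × (h * m1)).
  sw [:: h; m; l].
swr ltac:(rewrite crossE').
transitivity (\sw_(m1, m2 <- m) l × ((\sw_(a, b <- m2) b × T a) × (h * m1))).
  sw_with [:: h; m; l] ltac:(rewrite -?crossA).
swr ltac:(rewrite T_right).
sw_with [:: h; m; l] ltac:(rewrite ?cross1).
Qed.

(** Once the right-hand side is written with [twisted], multiplication by a leg
    of [l] turns both sides into [(h * m) × l]. *)
Let mul_colon h m l : (h * m) ∶ l =
  \sw_(m1, m2 <- m) \sw_(l1, l2 <- l) (h ∶ (l1 · m2)) * (m1 ∶ l2).
Proof.
transitivity (\sw_(m1, m2 <- m) \sw_(l1, l2 <- l)
    (h ∶ (l2 · m1)) * (m2 ∶ l1)); last first.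
  rewrite sw_exchange [RHS]sw_exchange.
  apply: (twisted_commuteE (f := fun u v => (h ∶ v) * u) twisted); lin.
move: l; apply: cancel_right'; [by lin | by lin | move=> l].
rewrite crossE'; symmetry.
transitivity (\sw_(m1, m2 <- m) \sw_(l1, l2 <- l)
    (h ∶ (l2 · m1)) * (\sw_(a, b <- l1) (m2 ∶ b) * a)).
  sw_with [:: h; m; l] ltac:(rewrite -?mulA).
swr ltac:(rewrite crossE' -crossE).
transitivity (\sw_(m1, m2 <- m) (\sw_(u, v <- l · m1) (h ∶ v) * u) * m2).
  sw_with [:: h; m; l] ltac:(rewrite -?mulA).
swr ltac:(rewrite crossE' cross_mul).
transitivity (\sw_(m1, m' <- m) \sw_(m2, m3 <- m')
    ((h * m3) × T m2) × (\sw_(a, b <- m1) (l · a) * b)).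
  sw [:: h; m; l].
swr ltac:(rewrite crossE).
transitivity (\sw_(m1, m2 <- m) (h * m2) × ((\sw_(a, b <- m1) T b × a) × l)).
  sw_with [:: h; m; l] ltac:(rewrite -?crossA).
swr ltac:(rewrite T_left).
sw_with [:: h; m; l] ltac:(rewrite ?cross1).
Qed.

Let cross_dot h m l : (m × l) · h = \sw_(h1, h2 <- h) (m · h1) × (l · h2).
Proof.
transitivity (\sw_(h1, h2 <- h) ((h1 × m) × l) * S h2).
  by apply: eq_sw => a b; rewrite crossA.
swr ltac:(rewrite cross_mul).
transitivity (\sw_(h1, h2 <- h) (\sw_(a, b <- h1) (a × m) * S b) ×
    (\sw_(a, b <- h2) T (S a) × (l * S b))).
  sw_with [:: h; m; l] ltac:(rewrite -?crossA).
by apply: eq_sw => a b; rewrite (dotE l b).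
Qed.

(** Here the cancellable factor is [z1 · y2]; multiplying by it turns both sides
    into [(x × z) · y]. *)
Let cycle2 x y z : \sw_(y1, y2 <- y) (x · y1) ∶ (z · y2) =
  \sw_(z1, z2 <- z) (x ∶ z2) · (y ∶ z1).
Proof.
have E (F : H -> H -> H) : is_bilinear F ->
    (forall y z, \sw_(y1, y2 <- y) \sw_(z1, z2 <- z) F y1 z2 * (z1 · y2) = (x × z) · y) ->
    forall y z, F y z = \sw_(y1, y2 <- y) \sw_(z1, z2 <- z)
      ((x × z2) · y1) * Si (z1 · y2).
  move=> bF FE {}y {}z; symmetry; swr ltac:(rewrite -FE).
  transitivity (\sw_(y1, y2 <- y) \sw_(z1, z2 <- z)
    F y1 z2 * (\sw_(u, v <- z1 · y2) v * Si u)).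
    sw_with [:: y; z] ltac:(rewrite -?mulA).
  swr ltac:(rewrite Sir).
  sw_with [:: y; z] ltac:(rewrite ?mulr1).
rewrite (E (fun y z => \sw_(y1, y2 <- y) (x · y1) ∶ (z · y2))); [|by lin|move=> {}y {}z].
  rewrite (E (fun y z => \sw_(z1, z2 <- z) (x ∶ z2) · (y ∶ z1)));
    [by []|by lin|move=> {}y {}z].
  transitivity (\sw_(z1, z2 <- z) ((x ∶ z2) * z1) · y).
    symmetry; swr ltac:(rewrite mul_dot).
    sw [:: y; z].
  rewrite -crossE'; sw [:: y; z].
rewrite cross_dot; symmetry; swr ltac:(rewrite -crossE').
sw [:: y; z].
Qed.

(** As [·] is a module structure, the inverse acts by [Si] of the same leg. *)
Let dot_invertible :
  bijective (tlift (fun x y : H => \sw_(y1, y2 <- y) (x · y1) ⊗ y2)).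
Proof.
have bf : is_bilinear (fun x y : H => \sw_(y1, y2 <- y) (x · y1) ⊗ y2) by lin.
have bg : is_bilinear (fun x y : H => \sw_(y1, y2 <- y) (x · Si y1) ⊗ y2) by lin.
have lf := tlift_linear bf; have lg := tlift_linear bg.
exists (tlift (fun x y : H => \sw_(y1, y2 <- y) (x · Si y1) ⊗ y2)).
  elim/tens_ind => [|x y|s t IHs IHt]; first by rewrite (lin0 lf) (lin0 lg).
    rewrite tlift_pure // (sw_hoist _ _ lg).
    swr ltac:(rewrite tlift_pure //).
    transitivity (\sw_(y1, y2 <- y) (x · (\sw_(a, b <- y1) Si b * a)) ⊗ y2).
      sw_with [:: x; y] ltac:(rewrite ?dotM).
    swr ltac:(rewrite Sil).
    sw_with [:: x; y] ltac:(rewrite ?dot1).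
  by rewrite (linD lf) (linD lg) IHs IHt.
elim/tens_ind => [|x y|s t IHs IHt]; first by rewrite (lin0 lg) (lin0 lf).
  rewrite tlift_pure // (sw_hoist _ _ lf).
  swr ltac:(rewrite tlift_pure //).
  transitivity (\sw_(y1, y2 <- y) (x · (\sw_(a, b <- y1) b * Si a)) ⊗ y2).
    sw_with [:: x; y] ltac:(rewrite ?dotM).
  swr ltac:(rewrite Sir).
  sw_with [:: x; y] ltac:(rewrite ?dot1).
by rewrite (linD lg) (linD lf) IHs IHt.
Qed.

Lemma gv_skew_brace : is_hopf_skew_brace mul one S dot colon.
Proof.
split; last by move=> h m; rewrite crossE' crossE.
split=> //.
- exact: dot_anticomul.2.
- exact: colon_anticomul.2.
- exact: (braiding_coalg dot_bil colon_bil dot_anticomul colon_anticomul twisted).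
- move=> x y z; transitivity (x · (z × y)).
    rewrite -crossE'; sw_with [:: x; y; z] ltac:(rewrite ?dotM).
  rewrite -crossE; sw_with [:: x; y; z] ltac:(rewrite ?dotM).
- move=> x y z; transitivity (x ∶ (z × y)).
    rewrite -crossE'; sw_with [:: x; y; z] ltac:(rewrite ?colonM).
  rewrite -crossE; sw_with [:: x; y; z] ltac:(rewrite ?colonM).
Qed.

End GVToSkewBrace.

(** * The equivalence *)

Theorem theorem6p23 (k : fieldType) (H : coalgType k) :
  [/\ (forall (mul : H -> H -> H) (one : H) (S : H -> H) (dot colon : H -> H -> H),
        is_hopf_skew_brace mul one S dot colon -> bijective S ->
        let cross := fun h l : H => \sw_(h1, h2 <- h) mul (dot l h1) h2 in
        let T := fun h : H => \sw_(h1, h2 <- h) expo dot (S h1) h2 in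
        (forall h : H, T h = \sw_(h1, h2 <- h) dot (S h1) (inverse S h2)) /\
        is_linear_q_cycle_coalgebra cross T dot one),
      (forall (cross : H -> H -> H) (T : H -> H) (dot : H -> H -> H) (one : H),
        is_linear_q_cycle_coalgebra cross T dot one ->
        let mul := fun h l : H => \sw_(l1, l2 <- l) cross l2 (expo dot h l1) in
        let S := fun h : H => \sw_(h1, h2 <- h) dot (T h1) h2 in
        [/\ is_hopf_algebra mul one S,
            bijective S
          & is_gv_hopf_skew_brace mul one S cross T])
    & (forall (mul : H -> H -> H) (one : H) (S : H -> H) (cross : H -> H -> H)
          (T : H -> H),
        is_gv_hopf_skew_brace mul one S cross T ->
        let dot := fun h l : H => \sw_(l1, l2 <- l) mul (cross l1 h) (S l2) in
        let colon := fun h l : H =>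
          \sw_(l1, l2 <- l) mul (cross h l2) (inverse S l1) in
        is_hopf_skew_brace mul one S dot colon /\ bijective S)].
Proof.
split.
- move=> mul one S dot colon brace S_bij cross T.
  exact: skew_brace_cycle_coalgebra brace S_bij.
- move=> cross T dot one cycle mul S; split.
  + exact: cycle_coalgebra_hopf cycle.
  + exact: lqc_antipode_bij cycle.
  + exact: cycle_coalgebra_gv cycle.
- move=> mul one S cross T gv dot colon; split; last exact: gv_antipode_bij gv.
  exact: gv_skew_brace gv.
Qed.
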